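(* Let $\Omega_D\subseteq\mathbb{H}$ be a slice domain and let $f:\Omega_{D}\to\mathbb{H}$ be a regular function. Let $K\subset D$ be a compact set containing an accumulation point. Then either $\mathcal{Z}(f)_{\mathbb{C}}\cap K$ is finite or $f\equiv0$.
   Context: $\mathbb{H}$ denotes the quaternions, $\mathbb{S}=\{I\in\mathbb{H}: I^2=-1\}$. Let $\mathbb{H}_{\mathbb{C}}=\mathbb{H}\otimes_{\mathbb{R}}\mathbb{C}=\{p+\imath q: p,q\in\mathbb{H}\}$ with product $(p_1+\imath q_1)(p_2+\imath q_2)=p_1p_2-q_1q_2+\imath(p_1q_2+q_1p_2)$ and $\overline{p+\imath q}=p-\imath q$. For an open $D\subseteq\mathbb{C}$ symmetric under complex conjugation, $\Omega_D=\{\alpha+I\beta:\alpha+i\beta\in D, I\in\mathbb{S}\}$; it is assumed to be a domain, and is called a slice domain if $D\cap\mathbb{R}\neq\emptyset$. A stem function is $F=F_1+\imath F_2:D\to\mathbb{H}_{\mathbb{C}}$ with $F(\bar z)=\overline{F(z)}$; it induces the slice function $f=\mathcal{I}(F):\Omega_D\to\mathbb{H}$, $f(\alpha+I\beta)=F_1(\alpha+i\beta)+IF_2(\alpha+i\beta)$. $f$ is regular if $F$ is $C^1$ and $\partial F/\partial\alpha+\imath\,\partial F/\partial\beta=0$. $\mathcal{Z}(f)=\{x\in\Omega_D: f(x)=0\}$. For $V\subset\mathbb{H}$, $V_{\mathbb{C}}=\{\alpha+i\beta\in\mathbb{C}:\alpha+I\beta\in V\text{ for some }I\in\mathbb{S}\}$.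 *)

(* Defs.v *)
From HB Require Import structures.
From mathcomp Require Import all_boot all_order all_algebra.
From mathcomp Require Import all_classical all_reals all_analysis.
From mathcomp Require Import complex.
From mathcomp Require Import ring.

Set Implicit Arguments.
Unset Strict Implicit.
Unset Printing Implicit Defensive.

Import Order.TTheory GRing.Theory Num.Theory.
Import numFieldNormedType.Exports.

Local Open Scope classical_set_scope.
Local Open Scope ring_scope.
Local Open Scope complex_scope.

(* R[i] carries the topology of its modulus, as every numFieldType does. *)
HB.instance Definition _ (R : rcfType) := NormedModule.copy R[i] (R[i])^o.

(* Quat a b c d stands for a + b i + c j + d k. *)
Record quat (R : Type) : Type := Quat { qre : R; qi : R; qj : R; qk : R }.

Definition quat_tuple (R : Type) (x : quat R) : R * R * R * R :=
  (qre x, qi x, qj x, qk x).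

Definition tuple_quat (R : Type) (t : R * R * R * R) : quat R :=
  let: (a, b, c, d) := t in Quat a b c d.

Lemma quat_tupleK (R : Type) : cancel (@quat_tuple R) (@tuple_quat R).
Proof. by case. Qed.

HB.instance Definition _ (R : realType) :=
  Choice.copy (quat R) (can_type (@quat_tupleK R)).

Section QuatAlgebra.
Variable R : realType.
Implicit Types (x y z : quat R) (k : R).

Definition quat0 : quat R := Quat 0 0 0 0.
Definition quat1 : quat R := Quat 1 0 0 0.

Definition quat_opp x : quat R := Quat (- qre x) (- qi x) (- qj x) (- qk x).

Definition quat_add x y : quat R :=
  Quat (qre x + qre y) (qi x + qi y) (qj x + qj y) (qk x + qk y).

Definition quat_scale k x : quat R :=
  Quat (k * qre x) (k * qi x) (k * qj x) (k * qk x).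

Definition quat_mul x y : quat R :=
  let: Quat a1 b1 c1 d1 := x in
  let: Quat a2 b2 c2 d2 := y in
  Quat (a1 * a2 - b1 * b2 - c1 * c2 - d1 * d2)
       (a1 * b2 + b1 * a2 + c1 * d2 - d1 * c2)
       (a1 * c2 - b1 * d2 + c1 * a2 + d1 * b2)
       (a1 * d2 + b1 * c2 - c1 * b2 + d1 * a2).

Lemma quat_addA : associative quat_add.
Proof. by move=> x y z; congr Quat; exact: addrA. Qed.

Lemma quat_addC : commutative quat_add.
Proof. by move=> x y; congr Quat; exact: addrC. Qed.

Lemma quat_add0 : left_id quat0 quat_add.
Proof. by case=> a b c d; congr Quat; exact: add0r. Qed.

Lemma quat_addN : left_inverse quat0 quat_opp quat_add.
Proof. by move=> x; congr Quat; exact: addNr. Qed.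

HB.instance Definition _ := GRing.isZmodule.Build (quat R)
  quat_addA quat_addC quat_add0 quat_addN.

Lemma quat_mulA : associative quat_mul.
Proof. by case=> ? ? ? ? [? ? ? ?] [? ? ? ?]; congr Quat; ring. Qed.

Lemma quat_mul1l : left_id quat1 quat_mul.
Proof. by case=> ? ? ? ?; congr Quat; ring. Qed.

Lemma quat_mul1r : right_id quat1 quat_mul.
Proof. by case=> ? ? ? ?; congr Quat; ring. Qed.

Lemma quat_mulDl : left_distributive quat_mul quat_add.
Proof.
by case=> ? ? ? ? [? ? ? ?] [? ? ? ?]; congr Quat => /=; ring.
Qed.

Lemma quat_mulDr : right_distributive quat_mul quat_add.
Proof.
by case=> ? ? ? ? [? ? ? ?] [? ? ? ?]; congr Quat => /=; ring.
Qed.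

Lemma quat1_neq0 : quat1 != 0.
Proof. by apply/eqP => -[] /eqP; rewrite oner_eq0. Qed.

HB.instance Definition _ := GRing.Zmodule_isNzRing.Build (quat R)
  quat_mulA quat_mul1l quat_mul1r quat_mulDl quat_mulDr quat1_neq0.

Lemma quat_scaleA k l x : quat_scale k (quat_scale l x) = quat_scale (k * l) x.
Proof. by congr Quat => /=; exact: mulrA. Qed.

Lemma quat_scale1 : left_id 1 quat_scale.
Proof. by case=> ? ? ? ?; congr Quat; exact: mul1r. Qed.

Lemma quat_scaleDr : right_distributive quat_scale +%R.
Proof. by move=> ? ? ?; congr Quat => /=; exact: mulrDr. Qed.

Lemma quat_scaleDl x : {morph quat_scale^~ x : k l / k + l}.
Proof. by move=> ? ?; congr Quat => /=; exact: mulrDl. Qed.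

HB.instance Definition _ := GRing.Zmodule_isLmodule.Build R (quat R)
  quat_scaleA quat_scale1 quat_scaleDr quat_scaleDl.

Lemma quat_scaleAl k x y : k *: (x * y) = quat_scale k x * y.
Proof. by case: x y => ? ? ? ? [? ? ? ?]; congr Quat => /=; ring. Qed.

HB.instance Definition _ :=
  GRing.Lmodule_isLalgebra.Build R (quat R) quat_scaleAl.

Lemma quat_scaleAr k x y : k *: (x * y) = x * (k *: y).
Proof. by case: x y => ? ? ? ? [? ? ? ?]; congr Quat => /=; ring. Qed.

HB.instance Definition _ :=
  GRing.Lalgebra_isAlgebra.Build R (quat R) quat_scaleAr.

Definition quat_norm x : R :=
  Num.sqrt (qre x ^+ 2 + qi x ^+ 2 + qj x ^+ 2 + qk x ^+ 2).

Lemma quat_normD x y : quat_norm (x + y) <= quat_norm x + quat_norm y.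
Proof.
case: x y => a1 b1 c1 d1 [a2 b2 c2 d2]; rewrite /quat_norm /=.
set X := a1 ^+ 2 + _ + _ + _; set Y := a2 ^+ 2 + _ + _ + _.
have X0 : 0 <= X by rewrite !addr_ge0 // sqr_ge0.
have Y0 : 0 <= Y by rewrite !addr_ge0 // sqr_ge0.
set dot := a1 * a2 + b1 * b2 + c1 * c2 + d1 * d2.
have dotE : dot <= Num.sqrt X * Num.sqrt Y.
  rewrite -sqrtrM // (le_trans (ler_norm _)) // -sqrtr_sqr ler_sqrt ?mulr_ge0 //.
  rewrite -subr_ge0.
  suff -> : X * Y - dot ^+ 2 =
      (a1 * b2 - b1 * a2) ^+ 2 + (a1 * c2 - c1 * a2) ^+ 2 +
      (a1 * d2 - d1 * a2) ^+ 2 + (b1 * c2 - c1 * b2) ^+ 2 +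
      (b1 * d2 - d1 * b2) ^+ 2 + (c1 * d2 - d1 * c2) ^+ 2.
    by rewrite !addr_ge0 // sqr_ge0.
  by rewrite /X /Y /dot; ring.
rewrite -[leRHS]ger0_norm ?addr_ge0 ?sqrtr_ge0 // -sqrtr_sqr ler_sqrt ?sqr_ge0 //.
rewrite [leRHS]sqrrD !sqr_sqrtr //.
rewrite [leLHS](_ : _ = X + dot *+ 2 + Y); last by rewrite /X /Y /dot; ring.
by rewrite lerD2r lerD2l lerMn2r.
Qed.

Lemma quat_normZ k x : quat_norm (k *: x) = `|k| * quat_norm x.
Proof.
rewrite /quat_norm /= -sqrtr_sqr -sqrtrM ?sqr_ge0 //.
by congr Num.sqrt; ring.
Qed.

Lemma quat_norm_eq0 x : quat_norm x = 0 -> x = 0.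
Proof.
case: x => a b c d /eqP; rewrite sqrtr_eq0 /= => h.
have : a ^+ 2 + b ^+ 2 + c ^+ 2 + d ^+ 2 == 0.
  by rewrite eq_le h !addr_ge0 // sqr_ge0.
rewrite !paddr_eq0 ?addr_ge0 ?sqr_ge0 // !sqrf_eq0.
by move=> /andP[/andP[/andP[/eqP-> /eqP->] /eqP->] /eqP->].
Qed.

HB.instance Definition _ := Lmodule_isNormed.Build R (quat R)
  quat_normD quat_normZ quat_norm_eq0.

End QuatAlgebra.

(* CQuat p q stands for p + ι q in the complexification of the quaternions. *)
Record cquat (R : Type) : Type := CQuat { cq1 : quat R; cq2 : quat R }.

Definition cquat_pair (R : Type) (x : cquat R) : quat R * quat R :=
  (cq1 x, cq2 x).

Definition pair_cquat (R : Type) (t : quat R * quat R) : cquat R :=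
  CQuat t.1 t.2.

Lemma cquat_pairK (R : Type) : cancel (@cquat_pair R) (@pair_cquat R).
Proof. by case. Qed.

HB.instance Definition _ (R : realType) :=
  Choice.copy (cquat R) (can_type (@cquat_pairK R)).

Section CquatAlgebra.
Variable R : realType.
Implicit Types (x y z : cquat R) (k : R).

Definition cquat0 : cquat R := CQuat 0 0.
Definition cquat1 : cquat R := CQuat 1 0.

Definition cquat_opp x : cquat R := CQuat (- cq1 x) (- cq2 x).

Definition cquat_add x y : cquat R :=
  CQuat (cq1 x + cq1 y) (cq2 x + cq2 y).

Definition cquat_scale k x : cquat R := CQuat (k *: cq1 x) (k *: cq2 x).

Definition cquat_mul x y : cquat R :=
  CQuat (cq1 x * cq1 y - cq2 x * cq2 y) (cq1 x * cq2 y + cq2 x * cq1 y).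

Lemma cquat_addA : associative cquat_add.
Proof. by move=> x y z; congr CQuat; exact: addrA. Qed.

Lemma cquat_addC : commutative cquat_add.
Proof. by move=> x y; congr CQuat; exact: addrC. Qed.

Lemma cquat_add0 : left_id cquat0 cquat_add.
Proof. by case=> p q; congr CQuat; exact: add0r. Qed.

Lemma cquat_addN : left_inverse cquat0 cquat_opp cquat_add.
Proof. by move=> x; congr CQuat; exact: addNr. Qed.

HB.instance Definition _ := GRing.isZmodule.Build (cquat R)
  cquat_addA cquat_addC cquat_add0 cquat_addN.

Lemma cquat_mulA : associative cquat_mul.
Proof.
case=> p1 q1 [p2 q2] [p3 q3]; congr CQuat => /=.
- rewrite mulrBr mulrBl !mulrDl !mulrDr !mulrA !opprD -!addrA.
  by congr (_ + _); rewrite addrA addrC.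
- rewrite mulrBr mulrBl !mulrDl !mulrDr !mulrA -!addrA.
  by congr (_ + _); rewrite addrA addrC.
Qed.

Lemma cquat_mul1l : left_id cquat1 cquat_mul.
Proof.
by case=> p q; congr CQuat => /=; rewrite mul1r mul0r ?subr0 ?addr0.
Qed.

Lemma cquat_mul1r : right_id cquat1 cquat_mul.
Proof.
by case=> p q; congr CQuat => /=; rewrite mulr1 mulr0 ?subr0 ?add0r.
Qed.

Lemma cquat_mulDl : left_distributive cquat_mul cquat_add.
Proof.
by move=> x y z; congr CQuat => /=; rewrite !mulrDl ?opprD addrACA.
Qed.

Lemma cquat_mulDr : right_distributive cquat_mul cquat_add.
Proof.
by move=> x y z; congr CQuat => /=; rewrite !mulrDr ?opprD addrACA.
Qed.

Lemma cquat1_neq0 : cquat1 != 0.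
Proof. by apply/eqP => -[] /eqP; rewrite oner_eq0. Qed.

HB.instance Definition _ := GRing.Zmodule_isNzRing.Build (cquat R)
  cquat_mulA cquat_mul1l cquat_mul1r cquat_mulDl cquat_mulDr cquat1_neq0.

Lemma cquat_scaleA k l x :
  cquat_scale k (cquat_scale l x) = cquat_scale (k * l) x.
Proof. by congr CQuat => /=; exact: scalerA. Qed.

Lemma cquat_scale1 : left_id 1 cquat_scale.
Proof. by case=> ? ?; congr CQuat; exact: scale1r. Qed.

Lemma cquat_scaleDr : right_distributive cquat_scale +%R.
Proof. by move=> ? ? ?; congr CQuat => /=; exact: scalerDr. Qed.

Lemma cquat_scaleDl x : {morph cquat_scale^~ x : k l / k + l}.
Proof. by move=> ? ?; congr CQuat => /=; exact: scalerDl. Qed.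

HB.instance Definition _ := GRing.Zmodule_isLmodule.Build R (cquat R)
  cquat_scaleA cquat_scale1 cquat_scaleDr cquat_scaleDl.

(* Only the topology of this norm is used, so any equivalent norm would do. *)
Definition cquat_norm x : R := `|cq1 x| + `|cq2 x|.

Lemma cquat_normD x y : cquat_norm (x + y) <= cquat_norm x + cquat_norm y.
Proof. by rewrite /cquat_norm /= addrACA lerD // ler_normD. Qed.

Lemma cquat_normZ k x : cquat_norm (k *: x) = `|k| * cquat_norm x.
Proof. by rewrite /cquat_norm /= !normrZ mulrDr. Qed.

Lemma cquat_norm_eq0 x : cquat_norm x = 0 -> x = 0.
Proof.
case: x => p q /eqP; rewrite paddr_eq0 //= !normr_eq0.
by move=> /andP[/eqP-> /eqP->].
Qed.

HB.instance Definition _ := Lmodule_isNormed.Build R (cquat R)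
  cquat_normD cquat_normZ cquat_norm_eq0.

Definition ciota : cquat R := CQuat 0 1.

Definition cquat_conj x : cquat R := CQuat (cq1 x) (- cq2 x).

End CquatAlgebra.

Section SliceRegular.
Variable R : realType.

Definition imag_units : set (quat R) := [set I | I ^+ 2 = -1].

Definition slice_pt (a b : R) (I : quat R) : quat R := a *: 1 + b *: I.

Definition conj_symmetric (D : set R[i]) := forall z, D z -> D z^*.

Definition circularization (D : set R[i]) : set (quat R) :=
  [set x | exists a b I, [/\ D (a +i* b), imag_units I & x = slice_pt a b I]].

Definition is_domain (T : topologicalType) (A : set T) :=
  [/\ A !=set0, open A & connected A].

Definition slice_domain (D : set R[i]) :=
  [/\ open D, conj_symmetric D, is_domain (circularization D) &
      exists a : R, D a%:C].

(* Functions on D or on its circularization are total functions of which only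
   the values on that set matter. *)
Definition stem_function (D : set R[i]) (F : R[i] -> cquat R) :=
  forall z, D z -> F z^* = cquat_conj (F z).

Definition induces (D : set R[i]) (F : R[i] -> cquat R)
    (f : quat R -> quat R) :=
  forall a b I, D (a +i* b) -> imag_units I ->
    f (slice_pt a b I) = cq1 (F (a +i* b)) + I * cq2 (F (a +i* b)).

Definition along_re (F : R[i] -> cquat R) (z : R[i]) (t : R) : cquat R :=
  F (t +i* complex.Im z).
Definition along_im (F : R[i] -> cquat R) (z : R[i]) (t : R) : cquat R :=
  F (complex.Re z +i* t).

Definition partial_re F z : cquat R := derive1 (along_re F z) (complex.Re z).
Definition partial_im F z : cquat R := derive1 (along_im F z) (complex.Im z).

Definition C1_on (D : set R[i]) (F : R[i] -> cquat R) :=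
  (forall z, D z -> derivable (along_re F z) (complex.Re z) 1 /\
                    derivable (along_im F z) (complex.Im z) 1) /\
  (forall z, D z -> {for z, continuous (partial_re F)} /\
                    {for z, continuous (partial_im F)}).

Definition slice_regular (D : set R[i]) (f : quat R -> quat R) :=
  exists F : R[i] -> cquat R,
    [/\ stem_function D F, induces D F f, C1_on D F &
        forall z, D z -> partial_re F z + ciota R * partial_im F z = 0].

Definition zero_set (D : set R[i]) (f : quat R -> quat R) : set (quat R) :=
  [set x | circularization D x /\ f x = 0].

Definition complex_trace (V : set (quat R)) : set R[i] :=
  [set z | exists2 I, imag_units I &
             V (slice_pt (complex.Re z) (complex.Im z) I)].

End SliceRegular.

(* Main.v *)
Require Import Defs.
From HB Require Import structures.
From mathcomp Require Import all_boot all_order all_algebra.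
From mathcomp Require Import all_classical all_reals all_analysis.
From mathcomp Require Import complex.
From mathcomp Require Import ring lra.

Import Order.TTheory GRing.Theory Num.Theory.
Import numFieldNormedType.Exports.

Local Open Scope classical_set_scope.
Local Open Scope ring_scope.
Local Open Scope complex_scope.

Set Implicit Arguments.
Unset Strict Implicit.

Import ComplexField.Normc.

(* If z = a + ib lies in the trace of the zero set, then F1(z) = - I F2(z) for an
   imaginary unit I, so the normal function N = sum over the four quaternionic
   coordinates k of (F1_k + i F2_k)^2 vanishes at z. N is a complex holomorphic
   function; if it has infinitely many zeros in the compact set K they accumulate
   in D, and N vanishes identically. At a real point F2 is zero, hence N is there
   the sum of the squares of the coordinates of F1, and F vanishes on the real
   points of D. These accumulate in D, so each F1_k + i F2_k vanishes identically.

   The identity theorem rests on an integral-free Cauchy formula. Let w be in the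
   unit disc, om = exp(2 pi i / m), and let S(t) be the mean over j < m of
   f(w + t (om^j - w)) weighted by the Cauchy kernel (1 - w^m) om^j / (om^j - w).
   Since the increments of f around the polygon with vertices w + t (om^j - w) sum
   to zero, S is nearly constant in t for m large; S(0) = f(w), and S(1) is a
   polynomial in w whose coefficients are bounded independently of m. *)

Local Notation nc := normc.

(** * The real-valued modulus of a complex number *)

Section ComplexModulus.
Variable R : realType.
Local Notation C := R[i].
Implicit Types (x y z : C) (n : nat).

Lemma normc_ge0 z : 0 <= nc z.
Proof. by case: z => a b; exact: sqrtr_ge0. Qed.

Lemma normc_norm z : `|z| = (nc z)%:C.
Proof. by case: z. Qed.

Lemma normcX z n : nc (z ^+ n) = nc z ^+ n.
Proof.
elim: n => [|n IH]; first by rewrite !expr0 normc1.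
by rewrite !exprS normcM IH.
Qed.

Lemma normc_real (a : R) : nc a%:C = `|a|.
Proof. by rewrite /= expr0n addr0 sqrtr_sqr. Qed.

Lemma normc_nat n : nc (n%:R : C) = n%:R.
Proof. by rewrite normcMn normc1. Qed.

Lemma normc_sum (I : Type) (r : seq I) (P : pred I) (F : I -> C) :
  nc (\sum_(i <- r | P i) F i) <= \sum_(i <- r | P i) nc (F i).
Proof.
elim/big_ind2 : _ => //.
- by rewrite normc0.
- by move=> x1 x2 y1 y2 h1 h2; apply: le_trans (le_normcD _ _) _; exact: lerD.
Qed.

Lemma le_normcB x y : nc (x - y) <= nc x + nc y.
Proof. by rewrite -(normcN y) le_normcD. Qed.

Lemma normc_Re z : `|complex.Re z| <= nc z.
Proof.
by case: z => a b; rewrite -sqrtr_sqr ler_sqrt ?addr_ge0 ?sqr_ge0 //= lerDl sqr_ge0.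
Qed.

Lemma normc_Im z : `|complex.Im z| <= nc z.
Proof.
by case: z => a b; rewrite -sqrtr_sqr ler_sqrt ?addr_ge0 ?sqr_ge0 //= lerDr sqr_ge0.
Qed.

Lemma normc_le_ReIm z : nc z <= `|complex.Re z| + `|complex.Im z|.
Proof.
case: z => a b /=.
rewrite -[leRHS]ger0_norm ?addr_ge0 // -sqrtr_sqr ler_sqrt ?sqr_ge0 //.
by rewrite sqrrD !real_normK ?num_real // addrAC lerDl mulrn_wge0 // mulr_ge0.
Qed.

End ComplexModulus.

(** * A discrete Cauchy formula *)

Section DiscreteCauchy.
Variable R : realType.
Local Notation C := R[i].

(** Complex differentiability on the closed unit disc, with a single [d] for all base points, so
    that one mesh size controls the errors at all vertices of a polygon at once. The bound [M] later
    bounds the approximate Taylor coefficients. *)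
Definition unit_differentiable (f : C -> C) :=
  exists (f' : C -> C) (M : R),
    (forall z, nc z <= 1 -> nc (f z) <= M /\ nc (f' z) <= M) /\
    forall e : R, 0 < e -> exists2 d : R, 0 < d &
      forall z z', nc z <= 1 -> nc z' <= 1 -> nc (z' - z) < d ->
        nc (f z' - f z - f' z * (z' - z)) <= e * nc (z' - z).

Section Polygon.
Variables (f f' : C -> C) (e d : R) (m : nat) (om w : C).
Hypothesis e0 : 0 < e.
Hypothesis fE : forall z z', nc z <= 1 -> nc z' <= 1 -> nc (z' - z) < d ->
  nc (f z' - f z - f' z * (z' - z)) <= e * nc (z' - z).
Hypothesis om_prim : m.-primitive_root om.
Hypothesis om_norm : nc om = 1.
Hypothesis om1 : om != 1.
Hypothesis om_close : nc (om - 1) < d.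
Hypothesis w1 : nc w < 1.

(** The polygon with vertices [p t j] shrinks from the regular [m]-gon in the unit circle at [t = 1]
    to the point [w] at [t = 0]. Writing the kernel as a finite geometric sum makes it a polynomial
    in [w]. [S] is left unnormalized: it is [m] times the weighted mean. *)
Let p (t : R) j := w + t%:C * (om ^+ j - w).
Let kap j := \sum_(k < m) (w * om ^- j) ^+ k.
Let S t := \sum_(j < m) f (p t j) * kap j.

Let omX j : nc (om ^+ j) = 1.
Proof. by rewrite normcX om_norm expr1n. Qed.

Let omXU j : om ^+ j != 0.
Proof.
apply/eqP => h; have := omX j; rewrite h normc0 => /esym/eqP.
by rewrite oner_eq0.
Qed.

Let p_in t j : 0 <= t <= 1 -> nc (p t j) <= 1.
Proof.
move=> /andP[t0 t1]; have -> : p t j = (1 - t)%:C * w + t%:C * om ^+ j.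
  by rewrite /p rmorphB rmorph1 /=; ring.
apply: le_trans (le_normcD _ _) _; rewrite !normcM omX !normc_real.
rewrite !ger0_norm ?subr_ge0 //.
have : (1 - t) * nc w <= (1 - t) * 1 by rewrite ler_wpM2l ?subr_ge0 // ltW.
lra.
Qed.

(* The kernel is [(1 - w ^+ m) * z / (z - w)] at [z = om ^+ j]. *)
Let kapE j : (om ^+ j - w) * kap j = (1 - w ^+ m) * om ^+ j.
Proof.
have -> : om ^+ j - w = om ^+ j * (1 - w * om ^- j).
  by rewrite mulrBr mulr1 mulrCA mulfV ?omXU // mulr1.
rewrite -mulrA -[kap j]mul1r.
have -> : (1 - w * om ^- j) * (1 * kap j) = 1 - (w * om ^- j) ^+ m.
  rewrite mul1r -[1 in RHS](expr1n _ m) subrXX; congr (_ * _).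
  by apply: eq_bigr => k _; rewrite expr1n mul1r.
by rewrite mulrC exprMn exprVn -exprM mulnC exprM (prim_expr_order om_prim) expr1n invr1 mulr1.
Qed.

(** A discrete form of the vanishing of the integral of [f'] along a closed curve. The increments of
    [f] around the polygon telescope to zero, and each is [f' (p t j) * t * (om - 1) * om ^+ j] up
    to an error [e * t * nc (om - 1)]; dividing by [t * nc (om - 1)] is where [0 < t] is needed. *)
Let sum_deriv t : 0 < t <= 1 ->
  nc (\sum_(j < m) f' (p t j) * om ^+ j) <= e * m%:R.
Proof.
move=> /andP[t0 t1].
have tt : 0 <= t <= 1 by rewrite ltW.
have om1_gt0 : 0 < nc (om - 1).
  rewrite lt_def normc_ge0 andbT; apply/eqP => /eq0_normc /eqP.
  by rewrite subr_eq0 (negPf om1).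
pose err j := f (p t j.+1) - f (p t j) - f' (p t j) * (p t j.+1 - p t j).
have dp j : p t j.+1 - p t j = t%:C * (om - 1) * om ^+ j.
  by rewrite /p exprS; ring.
have ndp j : nc (p t j.+1 - p t j) = t * nc (om - 1).
  by rewrite dp !normcM omX mulr1 normc_real ger0_norm // ltW.
have errE j : nc (err j) <= e * (t * nc (om - 1)).
  rewrite -(ndp j); apply: fE; rewrite ?p_in // ndp.
  apply: le_lt_trans om_close; rewrite ler_piMl // normc_ge0 //.
have sum0 : t%:C * (om - 1) * (\sum_(j < m) f' (p t j) * om ^+ j) =
    - \sum_(j < m) err j.
  have : \sum_(j < m) (f (p t j.+1) - f (p t j)) = 0.
    rewrite -(big_mkord xpredT (fun j => f (p t j.+1) - f (p t j))).
    rewrite telescope_sumr // /p (prim_expr_order om_prim) expr0 subrr //.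
  move=> tel; rewrite /err sumrB tel sub0r opprK big_distrr /=.
  by apply: eq_bigr => j _; rewrite dp; ring.
have tom0 : 0 < t * nc (om - 1) by rewrite mulr_gt0.
rewrite -(ler_pM2l tom0).
have -> : t * nc (om - 1) = nc (t%:C * (om - 1)).
  by rewrite normcM normc_real gtr0_norm.
rewrite -normcM sum0 normcN.
apply: le_trans (normc_sum _ _ _) _.
apply: le_trans (ler_sum _ (fun (j : 'I_m) _ => errE j)) _.
rewrite sumr_const card_ord -mulr_natr normcM normc_real gtr0_norm //.
by rewrite le_eqVlt; apply/orP; left; apply/eqP; ring.
Qed.

(** To first order, [S t' - S t] is [t' - t] times the sum of [f' (p t j) * (om ^+ j - w) * kap j].
    By [kapE] the last two factors make [(1 - w ^+ m) * om ^+ j], so [sum_deriv] bounds the sum. The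
    linear part and the remainders contribute [2 * e * m%:R] each, per unit of [t]. *)
Let S_step t t' : 0 < t <= 1 -> 0 <= t' <= 1 -> 2 * `|t' - t| < d ->
  nc (S t' - S t) <= 4 * e * m%:R * `|t' - t|.
Proof.
move=> ht ht' htt'.
have tt : 0 <= t <= 1 by move: ht => /andP[/ltW-> ->].
have w_om j : nc (om ^+ j - w) <= 2.
  by apply: le_trans (le_normcB _ _) _; rewrite omX; move: w1; lra.
have wm : nc (1 - w ^+ m) <= 2.
  apply: le_trans (le_normcB _ _) _; rewrite normc1 normcX.
  by have : nc w ^+ m <= 1 by [rewrite exprn_ile1 ?normc_ge0 // ltW]; lra.
have dp j : p t' j - p t j = (t' - t)%:C * (om ^+ j - w).
  by rewrite /p rmorphB /=; ring.
pose err j := f (p t' j) - f (p t j) - f' (p t j) * (p t' j - p t j).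
have errE j : nc (err j) <= e * (`|t' - t| * nc (om ^+ j - w)).
  rewrite -normc_real -normcM -dp; apply: fE; rewrite ?p_in //.
  rewrite dp normcM normc_real; apply: le_lt_trans htt'.
  by rewrite mulrC ler_wpM2r.
have errkap j : nc (err j * kap j) <= 2 * e * `|t' - t|.
  rewrite normcM.
  apply: le_trans (ler_wpM2r (normc_ge0 _) (errE j)) _.
  rewrite -!mulrA -normcM kapE normcM omX mulr1.
  rewrite [leRHS]mulrCA ler_wpM2l ?(ltW e0) // mulrC ler_wpM2r //.
have -> : S t' - S t = (t' - t)%:C * (1 - w ^+ m) * (\sum_(j < m) f' (p t j) * om ^+ j)
     + \sum_(j < m) err j * kap j.
  rewrite /S -sumrB big_distrr -big_split; apply: eq_bigr => j _ /=.
  rewrite /err dp mulrBl.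
  have -> : (t' - t)%:C * (1 - w ^+ m) * (f' (p t j) * om ^+ j) =
     (t' - t)%:C * f' (p t j) * ((1 - w ^+ m) * om ^+ j) by ring.
  by rewrite -kapE; ring.
apply: le_trans (le_normcD _ _) _.
have h1 : nc ((t' - t)%:C * (1 - w ^+ m) * (\sum_(j < m) f' (p t j) * om ^+ j))
   <= 2 * e * m%:R * `|t' - t|.
  rewrite !normcM normc_real -mulrA mulrC ler_wpM2r //.
  rewrite -mulrA; apply: ler_pM; rewrite ?normc_ge0 //; exact: sum_deriv.
have h2 : nc (\sum_(j < m) err j * kap j) <= 2 * e * m%:R * `|t' - t|.
  apply: le_trans (normc_sum _ _ _) _.
  apply: le_trans (ler_sum _ (fun (j : 'I_m) _ => errkap j)) _.
  by rewrite sumr_const card_ord -mulr_natr; rewrite le_eqVlt; apply/orP; left; apply/eqP; ring.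
by apply: le_trans (lerD h1 h2) _; rewrite le_eqVlt; apply/orP; left; apply/eqP; ring.
Qed.

Let m_gt0 : (0 < m)%N. Proof. exact: prim_order_gt0 om_prim. Qed.

(** All vertices coincide with [w], and the kernel weights add up to [m]: summed over [j], the
    powers [om ^- (j * k)] cancel unless [k = 0]. *)
Let S0 : S 0 = m%:R * f w.
Proof.
rewrite /S /p; under eq_bigr do rewrite rmorph0 mul0r addr0.
rewrite -big_distrr /= mulrC; congr (_ * _).
rewrite exchange_big /=.
transitivity (\sum_(k < m) (if (k : nat) == 0%N then m%:R else 0) : C).
  apply: eq_bigr => k _; case: eqP => [->|/eqP k0].
    by under eq_bigr do rewrite expr0; rewrite sumr_const card_ord.
  under eq_bigr do rewrite exprMn.
  rewrite -big_distrr /=; apply/eqP; rewrite mulf_eq0; apply/orP; right.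
  have omk : om ^- k != 1.
    rewrite invr_eq1 -(prim_order_dvd om_prim) gtnNdvd // lt0n //.
  have : (om ^- k) ^+ m - 1 = 0.
    by rewrite exprVn -exprM mulnC exprM (prim_expr_order om_prim) expr1n invr1 subrr.
  rewrite subrX1 => /eqP; rewrite mulf_eq0 subr_eq0 (negPf omk) /= => /eqP h.
  apply/eqP; rewrite -[RHS]h; apply: eq_bigr => j _; by rewrite !exprVn -!exprM mulnC.
rewrite (bigD1 (Ordinal m_gt0)) //= big1 ?addr0 // => k kn0.
by case: eqP => // k0; case/eqP: kn0; exact: val_inj.
Qed.

Let S1 : S 1 = \sum_(k < m) (\sum_(j < m) f (om ^+ j) * om ^- (j * k)) * w ^+ k.
Proof.
rewrite /S /p /kap.
under eq_bigr do rewrite rmorph1 mul1r addrC subrK big_distrr /=.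
rewrite exchange_big; apply: eq_bigr => k _; rewrite big_distrl; apply: eq_bigr => j _ /=.
by rewrite exprMn exprVn -exprM; ring.
Qed.

(** The interval from 0 to 1 is cut into [N] equal steps, each changing [S] by at most
    [4 * e * m%:R / N%:R]; the total is then divided by [m]. The coefficients of the polynomial are
    the discrete Fourier coefficients of [f] on the [m]-th roots of unity. *)
Lemma polygon_cauchy : 0 < d ->
  nc (f w - \sum_(k < m) (m%:R^-1 * \sum_(j < m) f (om ^+ j) * om ^- (j * k)) * w ^+ k)
    <= 4 * e.
Proof.
move=> d0.
have mC0 : (m%:R : C) != 0 by rewrite pnatr_eq0 -lt0n.
have mR0 : 0 < m%:R :> R by rewrite ltr0n.
suff : nc (S 1 - S 0) <= 4 * e * m%:R.
  have -> : S 1 - S 0 = - (m%:R * (f w - \sum_(k < m)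
      (m%:R^-1 * \sum_(j < m) f (om ^+ j) * om ^- (j * k)) * w ^+ k)).
    rewrite S0 S1 mulrBr opprB; congr (_ - _).
    rewrite big_distrr; apply: eq_bigr => k _ /=.
    by rewrite !mulrA mulfV // mul1r.
  by rewrite normcN normcM normc_nat mulrC ler_pM2r.
have [N N0 Nd] : exists2 N : nat, (0 < N)%N & 2 / N%:R < d.
  exists (Num.truncn (2 / d)).+1 => //.
  rewrite ltr_pdivrMr ?ltr0n // mulrC -ltr_pdivrMr //; apply: truncnS_gt.
have N0R : 0 < N%:R :> R by rewrite ltr0n.
have -> : S 1 - S 0 = \sum_(0 <= i < N) (S (i.+1%:R / N%:R) - S (i%:R / N%:R)).
  by rewrite telescope_sumr // mul0r mulfV // gt_eqF.
rewrite big_mkord; apply: le_trans (normc_sum _ _ _) _.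
have st (i : 'I_N) : nc (S (i.+1%:R / N%:R) - S (i%:R / N%:R)) <= 4 * e * m%:R / N%:R.
  (* The step is taken backwards, from [i.+1 / N] to [i / N], because the base point in [S_step]
     must be positive, while [i] may be 0. *)
  rewrite -normcN opprB.
  have dE : `|i%:R / N%:R - i.+1%:R / N%:R| = 1 / N%:R :> R.
    rewrite -mulrBl -natr1 opprD addrA subrr sub0r mulNr normrN ger0_norm ?divr_ge0 //.
  rewrite -[N%:R^-1 in leRHS]mul1r -dE; apply: S_step.
  - by rewrite divr_gt0 ?ltr0n //= ler_pdivrMr // mul1r ler_nat.
  - by rewrite divr_ge0 //= ler_pdivrMr // mul1r ler_nat ltnW.
  - by rewrite dE mul1r.
apply: le_trans (ler_sum _ (fun (i : 'I_N) _ => st i)) _.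
rewrite sumr_const card_ord -[leLHS]mulr_natr mulfVK // gt_eqF //.
Qed.

End Polygon.
End DiscreteCauchy.

(** * Roots of unity, approximate Taylor expansions, and accumulating zeros *)

Section RootsOfUnity.
Variable R : realType.
Local Notation C := R[i].

Definition cis (a : R) : C := cos a +i* sin a.

Lemma cisX a n : cis a ^+ n = cis (a * n%:R).
Proof.
elim: n => [|n IH]; first by rewrite expr0 mulr0 /cis cos0 sin0.
rewrite exprS IH -natr1 mulrDr mulr1 addrC /cis cosD sinD.
by congr (_ +i* _); rewrite addrC.
Qed.

Lemma normc_cis a : nc (cis a) = 1.
Proof. by rewrite /= cos2Dsin2 sqrtr1. Qed.

(** Here [cos a] equals [1 - 2 * sin (a / 2) ^+ 2], and [sin (a / 2)] is positive because [a / 2]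
    lies strictly between 0 and [pi]. *)
Lemma cis_eq1 a : 0 < a < 2 * pi -> cis a != 1.
Proof.
move=> /andP[a0 a2]; rewrite eq_complex /= negb_and; apply/orP; left.
have s0 : 0 < sin (a / 2) by apply: sin_gt0_pi; apply/andP; split; lra.
have -> : a = a / 2 + a / 2 by lra.
have := cos2Dsin2 (a / 2); rewrite cosD -!expr2 => h.
by rewrite lt_eqF //; have := exprn_gt0 2 s0; lra.
Qed.

Lemma cis_prim m : (0 < m)%N -> m.-primitive_root (cis (2 * pi / m%:R)).
Proof.
move=> m0; apply/andP; split => //; apply/forallP => -[i im] /=; apply/eqP.
have mR : 0 < m%:R :> R by rewrite ltr0n.
rewrite unity_rootE cisX mulrAC; have [->|ne] := eqVneq i.+1 m.
  rewrite mulfK ?(gt_eqF mR) // mulrC mulr_natr /cis.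
  by apply/eqP; congr (_ +i* _); [rewrite cos2pi|rewrite sin2pi].
apply/negbTE/cis_eq1; rewrite divr_gt0 ?mulr_gt0 ?pi_gt0 ?ltr0n //=.
by rewrite ltr_pdivrMr // ltr_pM2l ?mulr_gt0 ?pi_gt0 // ltr_nat ltn_neqAle ne.
Qed.

Lemma cis_near1 (d : R) : 0 < d ->
  exists N : nat, forall m, (N <= m)%N -> nc (cis (2 * pi / m%:R) - 1) < d.
Proof.
move=> d0.
have d2 : 0 < d / 2 by lra.
have /cvgrPdist_lt/(_ _ d2)/nbhs_ballP[/= e1 e10 h1] := @continuous_cos R 0.
have /cvgrPdist_lt/(_ _ d2)/nbhs_ballP[/= e2 e20 h2] := @continuous_sin R 0.
pose e := Num.min e1 e2; have e0 : 0 < e by rewrite lt_min e10 e20.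
exists (Num.truncn (2 * pi / e)).+1 => m Nm.
have m0 : 0 < m%:R :> R by rewrite ltr0n; exact: leq_trans Nm.
set x := 2 * pi / m%:R.
have x0 : 0 < x by rewrite divr_gt0 ?mulr_gt0 ?pi_gt0.
have xe : x < e.
  rewrite ltr_pdivrMr // [ltRHS]mulrC -ltr_pdivrMr //.
  by apply: lt_le_trans (truncnS_gt _) _; rewrite ler_nat.
apply: le_lt_trans (normc_le_ReIm (cis x - 1)) _ => /=.
have {h1} := h1 x; have {h2} := h2 x.
rewrite /ball /= sub0r normrN gtr0_norm // cos0 sin0 sub0r normrN.
move: xe; rewrite lt_min => /andP[xe1 xe2] /(_ xe2) hs /(_ xe1) hc.
by rewrite subr0 distrC; lra.
Qed.

(** The [a m k] play the role of Taylor coefficients. As means of values of [f] on the unit circle,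
    up to factors of modulus 1, they are bounded by the bound on [f], whatever [m] and [k]. *)
Lemma polygonal_approximation (f : C -> C) : unit_differentiable f ->
  exists (a : nat -> nat -> C) (M : R),
    (forall m k, nc (a m k) <= M) /\
    forall w e, nc w < 1 -> 0 < e -> exists N : nat, forall m, (N <= m)%N ->
      nc (f w - \sum_(k < m) a m k * w ^+ k) <= e.
Proof.
move=> [f' [M [fM fE]]].
pose om m := cis (2 * pi / m%:R).
have M0 : 0 <= M.
  have := (fM 0 _).1; rewrite normc0 ler01 => /(_ isT).
  exact: le_trans (normc_ge0 _).
exists (fun m k => m%:R^-1 * \sum_(j < m) f (om m ^+ j) * om m ^- (j * k)), M; split.
  move=> m k; case: (posnP m) => [->|m0].
    by rewrite big_ord0 mulr0 normc0.
  have mR : 0 < m%:R :> R by rewrite ltr0n.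
  rewrite normcM normcV normc_nat mulrC.
  rewrite ler_pdivrMr //.
  apply: le_trans (normc_sum _ _ _) _.
  apply: (@le_trans _ _ (\sum_(j < m) M)); last first.
    by rewrite sumr_const card_ord mulr_natr.
  apply: ler_sum => j _.
  rewrite normcM normcV.
  rewrite !normcX normc_cis !expr1n invr1 mulr1.
  by apply: (fM _ _).1; rewrite normcX normc_cis expr1n.
move=> w e w1 e0.
have e4 : 0 < e / 4 by lra.
have [d d0 fd] := fE _ e4.
have [N HN] := cis_near1 d0.
(* With [m] at least 2 the root [om m] differs from 1. *)
exists (maxn N 2) => m; rewrite geq_max => /andP[Nm m2].
have mR : 0 < m%:R :> R by rewrite ltr0n (leq_trans _ m2).
have -> : e = 4 * (e / 4) by lra.
apply: (polygon_cauchy e4 fd) => //.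
- by apply: cis_prim; rewrite (leq_trans _ m2).
- exact: normc_cis.
- apply: cis_eq1; rewrite divr_gt0 ?mulr_gt0 ?pi_gt0 //=.
  by rewrite ltr_pdivrMr // ltr_pMr ?mulr_gt0 ?pi_gt0 // ltr1n.
- exact: HN.
Qed.

(* Zeros accumulating at [0] force the limiting Taylor coefficients to vanish one
   after the other. *)
Lemma unit_differentiable_zeros (f : C -> C) : unit_differentiable f ->
  (forall e : R, 0 < e -> exists z, [/\ 0 < nc z, nc z < e & f z = 0]) ->
  forall w, nc w < 1 -> f w = 0.
Proof.
move=> /polygonal_approximation[a [M [aM fa]]] facc.
have M0 : 0 <= M by apply: le_trans (aM 0%N 0%N); exact: normc_ge0.
(* A geometric tail bound, kept multiplied by [1 - nc w] so that the right-hand sum telescopes. *)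
have tail m n w : (n <= m)%N -> nc w < 1 ->
    (1 - nc w) * nc (\sum_(n <= k < m) a m k * w ^+ k) <= M * nc w ^+ n.
  move=> nm w1; have w0 := normc_ge0 w.
  have le1 : nc (\sum_(n <= k < m) a m k * w ^+ k) <= \sum_(n <= k < m) M * nc w ^+ k.
    apply: le_trans (normc_sum _ _ _) _; apply: ler_sum => k _.
    by rewrite normcM normcX ler_wpM2r // exprn_ge0.
  apply: le_trans (ler_wpM2l _ le1) _; first by rewrite subr_ge0 ltW.
  rewrite -big_distrr /= mulrCA ler_wpM2l // big_distrr /=.
  have -> : \sum_(n <= k < m) (1 - nc w) * nc w ^+ k =
      \sum_(n <= k < m) (- nc w ^+ k.+1 - (- nc w ^+ k)).
    by apply: eq_bigr => k _; rewrite exprS; ring.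
  rewrite (telescope_sumr (fun k => - nc w ^+ k)) // opprK addrC gerBl //.
  by rewrite exprn_ge0.
have head n w : (forall k, (k < n)%N -> forall e : R, 0 < e ->
      exists N : nat, forall m, (N <= m)%N -> nc (a m k) <= e) -> nc w <= 1 ->
    forall e : R, 0 < e -> exists N : nat, forall m, (N <= m)%N ->
      nc (\sum_(0 <= k < n) a m k * w ^+ k) <= e.
  move=> + w1; elim: n => [|n IH] h e e0.
    by exists 0%N => m _; rewrite big_geq // normc0 ltW.
  have e2 : 0 < e / 2 by lra.
  have [N1 h1] := IH (fun k kn => h k (ltnW kn)) _ e2.
  have [N2 h2] := h n (ltnSn n) _ e2.
  exists (maxn N1 N2) => m; rewrite geq_max => /andP[/h1 l1 /h2 l2].
  rewrite big_nat_recr //=; apply: le_trans (le_normcD _ _) _.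
  suff : nc (a m n * w ^+ n) <= nc (a m n) by lra.
  rewrite normcM normcX ler_piMr ?normc_ge0 // exprn_ile1 ?normc_ge0 //.
have split m n w : (n <= m)%N -> \sum_(k < m) a m k * w ^+ k =
    \sum_(0 <= k < n) a m k * w ^+ k + \sum_(n <= k < m) a m k * w ^+ k.
  by move=> nm; rewrite -(big_mkord xpredT (fun k => a m k * w ^+ k)) (big_cat_nat _ nm).
(* Strong induction on [n]. At a small zero [z] the approximating polynomial is nearly 0, its terms
   below [n] are negligible by induction, and those above [n] are of order [nc z ^+ n.+1]; hence
   [a m n * z ^+ n] is small compared with [nc z ^+ n]. *)
have a0 n : forall e : R, 0 < e -> exists N : nat, forall m, (N <= m)%N -> nc (a m n) <= e.
  elim/ltn_ind: n => n IH e e0.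
  have M1 : 0 < 8 * (M + 1) by lra.
  (* The bound 1/2 gives [1 - x >= 1/2] in the tail estimate, and the other bound then makes the
     tail at most [e / 4 * x ^+ n]. Using [M + 1] avoids a zero denominator. *)
  have r0 : 0 < Num.min 2^-1 (e / (8 * (M + 1))) by rewrite lt_min invr_gt0 ltr0n divr_gt0.
  have [z [z0]] := facc _ r0; rewrite lt_min => /andP[z2 ze] fz.
  set x := nc z in z0 z2 ze.
  have x1 : x < 1 by lra.
  have xn0 : 0 < x ^+ n by rewrite exprn_gt0.
  have e4 : 0 < e / 4 * x ^+ n by rewrite mulr_gt0 // divr_gt0.
  have [N1 h1] := fa z _ x1 e4.
  have [N2 h2] := head n z IH (ltW x1) _ e4.
  exists (maxn (maxn N1 N2) n.+1) => m; rewrite !geq_max => /andP[/andP[/h1 l1 /h2 l2] nm].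
  have l3 := tail _ _ _ nm x1.
  move: l1; rewrite fz sub0r normcN (split _ _ _ (ltnW nm)) (big_ltn nm).
  rewrite -/x in l3 *.
  set P := \sum_(0 <= k < n) _ in l2 *; set Q := \sum_(n.+1 <= k < m) _ in l3 *.
  move=> l1.
  have l4 : nc (a m n * z ^+ n) <= e / 4 * x ^+ n + e / 4 * x ^+ n + nc Q.
    have -> : a m n * z ^+ n = (P + (a m n * z ^+ n + Q)) - (P + Q) by ring.
    apply: le_trans (le_normcB _ _) _.
    rewrite -addrA; apply: lerD l1 _.
    by apply: le_trans (le_normcD P Q) _; rewrite lerD2r.
  rewrite normcM normcX -/x in l4.
  have l5 : M * x ^+ n.+1 <= e / 8 * x ^+ n.
    rewrite exprS mulrA ler_pM2r //.
    have : x * (8 * (M + 1)) < e by rewrite -ltr_pdivlMr.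
    by nra.
  have l6 : nc Q <= 2 * (M * x ^+ n.+1).
    have : 2^-1 * nc Q <= (1 - x) * nc Q by rewrite ler_wpM2r ?normc_ge0 //; lra.
    by lra.
  by rewrite -(ler_pM2r xn0); lra.
(* If [f w] were nonzero, with modulus [e], first [n] and then [m] can be chosen so that the
   approximation error, the head and the tail are each at most [e / 4], which is absurd. *)
move=> w w1; apply: eq0_normc; apply/eqP.
rewrite eq_le normc_ge0 andbT leNgt; apply/negP => fw0.
have w0 := normc_ge0 w.
set e := nc (f w) in fw0.
have e4 : 0 < e / 4 by lra.
have e5 : 0 < e / 4 * (1 - nc w) / (M + 1) by rewrite divr_gt0 ?mulr_gt0 //; lra.
have [n hn] : exists n, nc w ^+ n < e / 4 * (1 - nc w) / (M + 1).
  have : nc w ^+ n @[n --> \oo] --> (0 : R) by apply: cvg_expr; rewrite ger0_norm.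
  move=> /cvgrPdist_lt/(_ _ e5)[n _ /(_ n (leqnn n))] /=.
  by rewrite sub0r normrN ger0_norm ?exprn_ge0 // => h; exists n.
have [N1 h1] := fa w _ w1 e4.
have [N2 h2] := head n w (fun k _ => a0 k) (ltW w1) _ e4.
have m1 := leq_maxl (maxn N1 N2) n; have m2 := leq_maxr (maxn N1 N2) n.
set m := maxn _ n in m1 m2; move: m1; rewrite geq_max => /andP[/h1 l1 /h2 l2].
have l3 := tail _ _ _ m2 w1; move: l1; rewrite (split _ _ _ m2).
set P := \sum_(0 <= k < n) _ in l2 *; set Q := \sum_(n <= k < m) _ in l3 * => l1.
have : nc (f w) <= nc (f w - (P + Q)) + nc P + nc Q.
  have -> : f w = (f w - (P + Q)) + P + Q by ring.
  apply: le_trans (le_normcD _ _) _; rewrite lerD2r.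
  have -> : f w - (P + Q) + P + Q - (P + Q) = f w - (P + Q) by ring.
  exact: le_normcD.
suff : nc Q <= e / 4 by rewrite -/e; lra.
have w1' : 0 < 1 - nc w by lra.
rewrite -(ler_pM2l w1'); apply: le_trans l3 _.
apply: (@le_trans _ _ ((M + 1) * nc w ^+ n)); first by rewrite ler_wpM2r ?exprn_ge0 //; lra.
by rewrite mulrC -ler_pdivlMr ?(ltW hn) // ?[_ * (e / 4)]mulrC ?ltW //; lra.
Qed.

End RootsOfUnity.

(** * Sums and products of uniformly differentiable functions *)

Section UnitDifferentiableAlgebra.
Variable R : realType.
Local Notation C := R[i].

Lemma unit_differentiableD (f g : C -> C) :
  unit_differentiable f -> unit_differentiable g ->
  unit_differentiable (fun z => f z + g z).
Proof.
move=> [f' [M [fM fE]]] [g' [N [gN gE]]].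
exists (fun z => f' z + g' z), (M + N); split.
  move=> z z1; have [? ?] := fM z z1; have [? ?] := gN z z1.
  by split; apply: le_trans (le_normcD _ _) _; apply: lerD.
move=> e e0; have e2 : 0 < e / 2 by lra.
have [d1 d10 h1] := fE _ e2; have [d2 d20 h2] := gE _ e2.
exists (Num.min d1 d2); first by rewrite lt_min d10.
move=> z z' z1 z'1; rewrite lt_min => /andP[/(h1 _ _ z1 z'1) l1 /(h2 _ _ z1 z'1) l2].
have -> : f z' + g z' - (f z + g z) - (f' z + g' z) * (z' - z) =
  (f z' - f z - f' z * (z' - z)) + (g z' - g z - g' z * (z' - z)) by ring.
by apply: le_trans (le_normcD _ _) _; lra.
Qed.

Lemma unit_differentiableM (f g : C -> C) :
  unit_differentiable f -> unit_differentiable g ->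
  unit_differentiable (fun z => f z * g z).
Proof.
move=> [f' [M1 [fM fE]]] [g' [M2 [gM gE]]].
pose M := Num.max (Num.max M1 M2) 1.
have M_ge1 : 1 <= M by rewrite le_max lexx orbT.
have {}fM z : nc z <= 1 -> nc (f z) <= M /\ nc (f' z) <= M.
  by move=> /fM[h1 h2]; rewrite !le_max h1 h2.
have {}gM z : nc z <= 1 -> nc (g z) <= M /\ nc (g' z) <= M.
  by move=> /gM[h1 h2]; rewrite !le_max h1 h2 !orbT.
have M0 : 0 < M by lra.
exists (fun z => f' z * g z + f z * g' z), (M * M + M * M); split.
  move=> z z1; have [? ?] := fM z z1; have [? ?] := gM z z1.
  have MM : 0 <= M * M by rewrite mulr_ge0; lra.
  split.
    by rewrite normcM ler_wpDl // ler_pM ?normc_ge0.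
  apply: le_trans (le_normcD _ _) _.
  by rewrite !normcM lerD // ler_pM ?normc_ge0.
move=> e e0.
have e3 : 0 < e / (3 * M) by rewrite divr_gt0 //; lra.
have [d1 d10 h1] := fE _ e3; have [d2 d20 h2] := gE _ e3.
(* Differentiability with error 1 gives the local Lipschitz bound [(M + 1) * x] for [g]. *)
have [d3 d30 h3] := gE _ ltr01.
have d40 : 0 < e / (3 * M * (M + 1)) by rewrite divr_gt0 // !mulr_gt0 //; lra.
(* The remainder of the product splits into three terms, each at most [e / 3 * x]. In two of them a
   remainder of [f] or [g] meets a factor bounded by [M]; the mixed one is at most
   [M * (M + 1) * x ^+ 2], whence the last entry of the minimum. *)
exists (Num.min (Num.min d1 d2) (Num.min d3 (e / (3 * M * (M + 1))))).
  by rewrite !lt_min d10 d20 d30.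
move=> z z' z1 z'1; rewrite !lt_min.
move=> /andP[/andP[/(h1 _ _ z1 z'1) l1 /(h2 _ _ z1 z'1) l2] /andP[/(h3 _ _ z1 z'1) l3 l4]].
have -> : f z' * g z' - f z * g z - (f' z * g z + f z * g' z) * (z' - z) =
  (f z' - f z - f' z * (z' - z)) * g z' + f' z * (z' - z) * (g z' - g z)
   + f z * (g z' - g z - g' z * (z' - z)) by ring.
set x := nc (z' - z) in l1 l2 l3 l4 *.
have x0 : 0 <= x := normc_ge0 _.
have [fz f'z] := fM z z1; have [gz g'z] := gM z z1; have [gz' _] := gM z' z'1.
have t1 : nc ((f z' - f z - f' z * (z' - z)) * g z') <= e / 3 * x.
  have -> : e / 3 * x = e / (3 * M) * x * M by field; lra.
  by rewrite normcM ler_pM ?normc_ge0.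
have t3 : nc (f z * (g z' - g z - g' z * (z' - z))) <= e / 3 * x.
  have -> : e / 3 * x = M * (e / (3 * M) * x) by field; lra.
  by rewrite normcM ler_pM ?normc_ge0.
have lg : nc (g z' - g z) <= (M + 1) * x.
  have -> : g z' - g z = (g z' - g z - g' z * (z' - z)) + g' z * (z' - z) by ring.
  apply: le_trans (le_normcD _ _) _; rewrite mulrDl addrC lerD //.
  by rewrite normcM ler_wpM2r.
have t2 : nc (f' z * (z' - z) * (g z' - g z)) <= e / 3 * x.
  rewrite !normcM -/x.
  apply: (@le_trans _ _ (M * x * ((M + 1) * x))).
    by rewrite ler_pM ?mulr_ge0 ?normc_ge0 // ler_wpM2r.
  have -> : M * x * ((M + 1) * x) = (x * (M * (M + 1))) * x by ring.
  rewrite ler_wpM2r //.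
  have -> : e / 3 = e / (3 * M * (M + 1)) * (M * (M + 1)) by field; apply/andP; split; lra.
  by rewrite ler_wpM2r ?ltW // mulr_gt0 //; lra.
apply: le_trans (le_normcD _ _) _.
by have := le_normcD ((f z' - f z - f' z * (z' - z)) * g z') (f' z * (z' - z) * (g z' - g z)); lra.
Qed.

End UnitDifferentiableAlgebra.

(** * The Cauchy-Riemann equations and uniform differentiability *)

Section CauchyRiemann.
Variable R : realType.
Local Notation C := R[i].

(** Balls of [R[i]] have radii in [R[i]]; a radius that is positive in the order of [R[i]] has zero
    imaginary part, so real radii suffice. *)
Lemma nbhs_normcP (z : C) (P : set C) :
  nbhs z P <-> exists2 r : R, 0 < r & forall z', nc (z' - z) < r -> P z'.
Proof.
split.
  move=> /nbhs_ballP[[r s]] /=; rewrite ltcE /= => /andP[/eqP -> r0] h.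
  by exists r => // z' zr; apply: h; rewrite /ball /= distrC normc_norm ltcR.
move=> [r r0 h]; apply/nbhs_ballP; exists r%:C => /=; first by rewrite ltcR.
by move=> z'; rewrite /ball /= distrC normc_norm ltcR; apply: h.
Qed.

Lemma for_continuous_normc (V : normedModType R) (g : C -> V) (z : C) (e : R) :
  {for z, continuous g} -> 0 < e ->
  exists2 d : R, 0 < d & forall z', nc (z' - z) < d -> `|g z' - g z| < e.
Proof.
move=> /cvgrPdist_lt h e0; have /nbhs_normcP[d d0 hd] := h _ e0.
by exists d => // z' /hd; rewrite distrC.
Qed.

(** The Heine-Cantor theorem on a rectangle, with only the base point confined to it: [z] may lie
    outside. *)
Lemma square_uniform_continuous (g : C -> R) (a b a' b' : R) :
  (forall x y, a <= x <= a' -> b <= y <= b' -> {for x +i* y, continuous g}) ->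
  forall e : R, 0 < e -> exists2 d : R, 0 < d &
    forall x y, a <= x <= a' -> b <= y <= b' ->
    forall z, nc (z - (x +i* y)) < d -> `|g z - g (x +i* y)| < e.
Proof.
move=> gc e e0.
(* Compactness is used in its near-covering form: an estimate valid near each point of the rectangle
   for all small positive [d] is valid on the whole rectangle for all small positive [d]. *)
have := compact_setX (@segment_compact R a a') (@segment_compact R b b').
move=> /compact_near_coveringP/(_ _ (0 : R)^'+
  (fun d p => forall z, nc (z - (p.1 +i* p.2)) < d -> `|g z - g (p.1 +i* p.2)| < e) _).
case=> [[x y] /= [xa yb]|d /= d0 hd].
  rewrite in_itv /= in xa; rewrite in_itv /= in yb.
  have e2 : 0 < e / 2 by lra.
  have [d d0 h] := for_continuous_normc (gc _ _ xa yb) e2.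
  have d4 : 0 < d / 4 by lra.
  exists (ball x (d / 4) `*` ball y (d / 4), [set s : R | 0 < s < d / 2]).
    split => /=.
      by exists (ball x (d / 4), ball y (d / 4)) => //=; split; exact: nbhsx_ballx.
    near=> s; apply/andP; split; near: s; first exact: nbhs_right_gt.
    by apply: nbhs_right_lt; lra.
  move=> [[x' y'] s] /= [[]]; rewrite /ball /= => hx hy /andP[s0 sd] z hz.
  have l1 : nc ((x' +i* y') - (x +i* y)) < d / 2.
    apply: le_lt_trans (normc_le_ReIm ((x' +i* y') - (x +i* y))) _ => /=.
    by rewrite distrC [X in _ + X]distrC; lra.
  have l2 : nc (z - (x +i* y)) < d.
    have -> : z - (x +i* y) = (z - (x' +i* y')) + ((x' +i* y') - (x +i* y)) by ring.
    by apply: le_lt_trans (le_normcD _ _) _; lra.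
  have /h l1' : nc ((x' +i* y') - (x +i* y)) < d by lra.
  have := h _ l2; rewrite !ltr_norml in l1' * => /andP[? ?]; move: l1' => /andP[? ?].
  by apply/andP; split; lra.
have d2 : 0 < d / 2 by lra.
exists (d / 2) => // x y xa yb; apply: (hd (d / 2) _ _ (x, y)).
- by rewrite /= sub0r normrN gtr0_norm //; lra.
- by [].
- by split; rewrite /= in_itv.
Unshelve. all: by end_near. Qed.

(** The mean value theorem, phrased with distances so as to cover both orders of [x] and [y]. *)
Lemma mean_value (h h' : R -> R) (x y : R) :
  (forall t, `|t - x| <= `|y - x| -> `|t - y| <= `|y - x| -> is_derive t 1 h (h' t)) ->
  exists2 t, `|t - x| <= `|y - x| & h y - h x = h' t * (y - x).
Proof.
move=> hd; case: (leP x y) => xy.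
  have dd t : t \in `[x, y] -> is_derive t 1 h (h' t).
    rewrite in_itv /= => /andP[xt ty].
    by apply: hd; rewrite ![`|y - x|]ger0_norm ?ler_norml; lra.
  have [|t] := @MVT_segment R h h' x y xy (fun t ht => dd t (subset_itv_oo_cc ht)).
    by apply: derivable_within_continuous => t /dd[].
  rewrite in_itv /= => /andP[xt ty] hE; exists t => //.
  by rewrite !ger0_norm; lra.
have dd t : t \in `[y, x] -> is_derive t 1 h (h' t).
  rewrite in_itv /= => /andP[xt ty].
  by apply: hd; rewrite ![`|y - x|]ler0_norm ?ler_norml; lra.
have [|t] := @MVT_segment R h h' y x (ltW xy) (fun t ht => dd t (subset_itv_oo_cc ht)).
  by apply: derivable_within_continuous => t /dd[].
rewrite in_itv /= => /andP[xt ty] hE; exists t; last by lra.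
by rewrite !ler0_norm; lra.
Qed.

Definition C1_partials (D : set C) (u ux uy : C -> R) := forall z, D z ->
  [/\ is_derive (complex.Re z) 1 (fun t => u (t +i* complex.Im z)) (ux z),
      is_derive (complex.Im z) 1 (fun t => u (complex.Re z +i* t)) (uy z),
      {for z, continuous ux} & {for z, continuous uy}].

(** The increment of [u] is split along a vertical and a horizontal segment. The mean value theorem
    expresses each part by a partial derivative at an intermediate point, and uniform continuity
    moves that point to [z]. The factor 4 leaves room for a square of half-side [r] around [c]. *)
Lemma C1_partials_uniform (D : set C) (u ux uy : C -> R) (c : C) (r : R) :
  C1_partials D u ux uy ->
  (forall z, nc (z - c) <= 4 * r -> D z) ->
  forall e : R, 0 < e -> exists2 d : R, 0 < d &
    forall z z', nc (z - c) <= r -> nc (z' - c) <= r -> nc (z' - z) < d ->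
    `|u z' - u z - (ux z * complex.Re (z' - z) + uy z * complex.Im (z' - z))|
      <= e * nc (z' - z).
Proof.
move=> uC rD e e0.
have sq x y : complex.Re c - r <= x <= complex.Re c + r ->
    complex.Im c - r <= y <= complex.Im c + r -> D (x +i* y).
  move=> hx hy; apply: rD.
  have -> : c = complex.Re c +i* complex.Im c by case: (c).
  apply: le_trans (normc_le_ReIm ((x +i* y) - (complex.Re c +i* complex.Im c))) _ => /=.
  have : `|x - complex.Re c| <= r by rewrite ler_norml; lra.
  have : `|y - complex.Im c| <= r by rewrite ler_norml; lra.
  have := normr_ge0 (x - complex.Re c).
  lra.
have e2 : 0 < e / 2 by lra.
have ux_cont x y (hx : complex.Re c - r <= x <= complex.Re c + r)
    (hy : complex.Im c - r <= y <= complex.Im c + r) : {for x +i* y, continuous ux}.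
  by have [] := uC _ (sq _ _ hx hy).
have uy_cont x y (hx : complex.Re c - r <= x <= complex.Re c + r)
    (hy : complex.Im c - r <= y <= complex.Im c + r) : {for x +i* y, continuous uy}.
  by have [] := uC _ (sq _ _ hx hy).
have [d1 d10 h1] := square_uniform_continuous ux_cont e2.
have [d2 d20 h2] := square_uniform_continuous uy_cont e2.
(* The intermediate points differ from [z] by at most [nc (z' - z)] in each coordinate, hence by at
   most twice that in modulus. *)
exists (Num.min d1 d2 / 2); first by rewrite divr_gt0 // lt_min d10.
move=> [a b] [a' b'] zr z'r zz'.
have [az bz] : `|a - complex.Re c| <= r /\ `|b - complex.Im c| <= r.
  have := normc_Re ((a +i* b) - c); have := normc_Im ((a +i* b) - c).
  by case: (c) zr => c1 c2 /= zr; split; lra.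
have [az' bz'] : `|a' - complex.Re c| <= r /\ `|b' - complex.Im c| <= r.
  have := normc_Re ((a' +i* b') - c); have := normc_Im ((a' +i* b') - c).
  by case: (c) z'r => c1 c2 /= z'r; split; lra.
have da := normc_Re ((a' +i* b') - (a +i* b)); have db := normc_Im ((a' +i* b') - (a +i* b)).
set x := nc _ in zz' da db *; rewrite /= in da db.
have x0 : 0 <= x := normc_ge0 _.
have : x < d1 / 2 by apply: lt_le_trans zz' _; rewrite ler_pM2r // ge_min lexx.
have : x < d2 / 2 by apply: lt_le_trans zz' _; rewrite ler_pM2r // ge_min lexx orbT.
move=> xd2 xd1.
rewrite !ler_norml in az az' bz bz'.
have dx t : `|t - a| <= `|a' - a| -> `|t - a'| <= `|a' - a| ->
    is_derive t 1 (fun t => u (t +i* b')) (ux (t +i* b')).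
  move=> t1 t2; have [|] := uC (t +i* b') _ => //.
  apply: sq; last by lra.
  move: t1 t2; rewrite !ler_norml.
  by case: (leP a a') => aa; [rewrite ger0_norm|rewrite ltr0_norm]; lra.
have dy t : `|t - b| <= `|b' - b| -> `|t - b'| <= `|b' - b| ->
    is_derive t 1 (fun t => u (a +i* t)) (uy (a +i* t)).
  move=> t1 t2; have [|] := uC (a +i* t) _ => //.
  apply: sq; first by lra.
  move: t1 t2; rewrite !ler_norml.
  by case: (leP b b') => bb; [rewrite ger0_norm|rewrite ltr0_norm]; lra.
have [s sa sE] := mean_value dx; have [t tb tE] := mean_value dy.
have hab : complex.Re c - r <= a <= complex.Re c + r by lra.
have hba : complex.Im c - r <= b <= complex.Im c + r by lra.
have l1 : `|ux (s +i* b') - ux (a +i* b)| < e / 2.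
  apply: h1 => //.
  by apply: le_lt_trans (normc_le_ReIm ((s +i* b') - (a +i* b))) _ => /=; lra.
have l2 : `|uy (a +i* t) - uy (a +i* b)| < e / 2.
  apply: h2 => //.
  apply: le_lt_trans (normc_le_ReIm ((a +i* t) - (a +i* b))) _ => /=.
  by rewrite subrr normr0; lra.
have -> : u (a' +i* b') - u (a +i* b) - (ux (a +i* b) * complex.Re ((a' +i* b') - (a +i* b))
     + uy (a +i* b) * complex.Im ((a' +i* b') - (a +i* b))) =
    (ux (s +i* b') - ux (a +i* b)) * (a' - a) + (uy (a +i* t) - uy (a +i* b)) * (b' - b).
  rewrite /= !mulrBl -sE -tE; ring.
apply: le_trans (ler_normD _ _) _; rewrite !normrM.
have : `|ux (s +i* b') - ux (a +i* b)| * `|a' - a| <= e / 2 * x by rewrite ler_pM // ltW.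
have : `|uy (a +i* t) - uy (a +i* b)| * `|b' - b| <= e / 2 * x by rewrite ler_pM // ltW.
lra.
Qed.

End CauchyRiemann.

(** * From the Cauchy-Riemann equations to complex differentiability on small discs *)

Section LocalDifferentiability.
Variable R : realType.
Local Notation C := R[i].

(** Asking for all radii up to [r0], and not for one radius, lets two functions be rescaled from a
    common disc. *)
Definition locally_unit_differentiable (D : set C) (f : C -> C) :=
  forall c, D c -> exists2 r0 : R, 0 < r0 &
    forall r, 0 < r <= r0 -> unit_differentiable (fun z => f (c + r%:C * z)).

(** The derivative is [p + i q]: by the Cauchy-Riemann equations, the real and imaginary parts of
    its complex remainder are the real remainders of [u] and [v]. *)
Lemma cauchy_riemann (D : set C) (u v p q : C -> R) :
  open D -> C1_partials D u p (fun z => - q z) -> C1_partials D v q p ->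
  locally_unit_differentiable D (fun z => u z +i* v z).
Proof.
move=> Dopen uC vC c Dc.
have /nbhs_normcP[rho rho0 hD] := open_nbhs_nbhs (conj Dopen Dc).
have [_ _ pc _] := uC c Dc; have [_ _ qc _] := vC c Dc.
have [dp dp0 hp] := for_continuous_normc pc ltr01.
have [dq dq0 hq] := for_continuous_normc qc ltr01.
have r50 : 0 < rho / 5 by lra.
have D4 z : nc (z - c) <= 4 * (rho / 5) -> D z by move=> h; apply: hD; lra.
have hu := C1_partials_uniform uC D4; have hv := C1_partials_uniform vC D4.
have [du du0 hu1] := hu _ ltr01; have [dv dv0 hv1] := hv _ ltr01.
(* Radius at most 1 keeps rescaling from increasing distances; [rho / 5] keeps the fourfold disc in
   [D]; [dp] and [dq] keep [p] and [q] within 1 of their values at [c]; [du] and [dv] allow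
   expansion of [u] and [v] at [c] with error 1. The last two requirements supply the bounds on [f]
   and [f']. *)
pose r0 := Num.min (Num.min 1 (rho / 5)) (Num.min (Num.min dp dq / 2) (Num.min du dv / 2)).
exists r0; first by rewrite !lt_min ltr01 r50 /= !divr_gt0 // lt_min ?dp0 ?du0.
move=> r /andP[r_gt0]; rewrite !le_min => /andP[/andP[r1 r2] /andP[r3 r4]].
have {r3}[r3 r5] : r < dp /\ r < dq.
  have : Num.min dp dq <= dp by rewrite ge_min lexx.
  have : Num.min dp dq <= dq by rewrite ge_min lexx orbT.
  by split; lra.
have {r4}[r4 r6] : r < du /\ r < dv.
  have : Num.min du dv <= du by rewrite ge_min lexx.
  have : Num.min du dv <= dv by rewrite ge_min lexx orbT.
  by split; lra.
have nr (z : C) : nc z <= 1 -> nc (c + r%:C * z - c) <= r.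
  move=> z1; rewrite addrC addKr normcM normc_real gtr0_norm //.
  by rewrite ler_piMr // ltW.
pose f' z := p z +i* q z.
pose B := `|p c| + `|q c| + 1.
have abs_lin (k l : R) (z : C) : nc z <= 1 ->
    `|k * complex.Re z + l * complex.Im z| <= `|k| + `|l|.
  move=> z1; apply: le_trans (ler_normD _ _) _; rewrite !normrM.
  by rewrite lerD // ler_piMr // (le_trans _ z1) // ?normc_Re ?normc_Im.
have bound (w k l : C -> R) (z : C) :
    `|w z - w c - (k c * complex.Re (z - c) + l c * complex.Im (z - c))|
      <= 1 * nc (z - c) ->
    nc (z - c) <= 1 -> `|w z| <= `|w c| + (`|k c| + `|l c| + 1).
  move=> h1 h2; have h3 := abs_lin (k c) (l c) _ h2.
  have -> : w z = w c + ((k c * complex.Re (z - c) + l c * complex.Im (z - c)) +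
     (w z - w c - (k c * complex.Re (z - c) + l c * complex.Im (z - c)))) by ring.
  apply: le_trans (ler_normD _ _) _; rewrite lerD2l.
  by apply: le_trans (ler_normD _ _) _; lra.
have cc : nc (c - c) <= rho / 5 by rewrite subrr normc0 ltW.
exists (fun z => r%:C * f' (c + r%:C * z)), (`|u c| + `|v c| + 2 * B); split.
  move=> z /nr nz.
  set Z := c + r%:C * z in nz *.
  have hZ : nc (Z - c) <= rho / 5 by lra.
  have hZ1 : nc (Z - c) <= 1 by lra.
  have bu := bound u p (fun z => - q z) Z (hu1 _ _ cc hZ (le_lt_trans nz r4)) hZ1.
  have bv := bound v q p Z (hv1 _ _ cc hZ (le_lt_trans nz r6)) hZ1.
  rewrite normrN in bu.
  split.
    apply: le_trans (normc_le_ReIm (u Z +i* v Z)) _ => /=.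
    by rewrite /B; lra.
  rewrite normcM normc_real gtr0_norm //.
  have b1 : nc (f' Z) <= B + 1.
    apply: le_trans (normc_le_ReIm (f' Z)) _ => /=.
    have := hp _ (le_lt_trans nz r3); have := hq _ (le_lt_trans nz r5).
    have := ler_normD (p Z - p c) (p c); have := ler_normD (q Z - q c) (q c).
    by rewrite !subrK /B; lra.
  have : r * nc (f' Z) <= nc (f' Z) by rewrite ler_piMl // normc_ge0.
  have := normr_ge0 (u c); have := normr_ge0 (v c).
  have := normr_ge0 (p c); have := normr_ge0 (q c).
  by rewrite /B in b1 *; lra.
move=> e e0; have e2 : 0 < e / 2 by lra.
have [d1 d10 h1] := hu _ e2; have [d2 d20 h2] := hv _ e2.
exists (Num.min d1 d2); first by rewrite lt_min d10.
move=> z z' z1 z'1; rewrite lt_min => /andP[l1 l2].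
have nZ := nr _ z1; have nZ' := nr _ z'1.
have dZ : (c + r%:C * z') - (c + r%:C * z) = r%:C * (z' - z) by ring.
have -> : r%:C * f' (c + r%:C * z) * (z' - z) =
   f' (c + r%:C * z) * ((c + r%:C * z') - (c + r%:C * z)) by ring.
have ndZ : nc ((c + r%:C * z') - (c + r%:C * z)) <= nc (z' - z).
  rewrite dZ normcM normc_real gtr0_norm //.
  by rewrite ler_piMl // normc_ge0.
set Z := c + r%:C * z in nZ ndZ *; set Z' := c + r%:C * z' in nZ' ndZ *.
have := h1 _ _ (le_trans nZ r2) (le_trans nZ' r2) (le_lt_trans ndZ l1).
have := h2 _ _ (le_trans nZ r2) (le_trans nZ' r2) (le_lt_trans ndZ l2).
move=> b2 b1.
have E : u Z' +i* v Z' - (u Z +i* v Z) - f' Z * (Z' - Z) =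
  (u Z' - u Z - (p Z * complex.Re (Z' - Z) + - q Z * complex.Im (Z' - Z))) +i*
  (v Z' - v Z - (q Z * complex.Re (Z' - Z) + p Z * complex.Im (Z' - Z))).
  rewrite /f'; case: (Z' - Z) => a b.
  by apply/eqP; rewrite eq_complex /=; apply/andP; split; apply/eqP; ring.
rewrite E; apply: le_trans (normc_le_ReIm (_ +i* _)) _ => /=.
have : e / 2 * nc (Z' - Z) <= e / 2 * nc (z' - z) by rewrite ler_wpM2l // ltW.
lra.
Qed.

End LocalDifferentiability.

(** * The identity theorem *)

Section IdentityTheorem.
Variable R : realType.
Local Notation C := R[i].

Lemma locally_unit_differentiableD (D : set C) (f g : C -> C) :
  locally_unit_differentiable D f -> locally_unit_differentiable D g ->
  locally_unit_differentiable D (fun z => f z + g z).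
Proof.
move=> fD gD c Dc; have [r1 r10 h1] := fD c Dc; have [r2 r20 h2] := gD c Dc.
exists (Num.min r1 r2); first by rewrite lt_min r10.
move=> r /andP[r0]; rewrite le_min => /andP[l1 l2].
by apply: unit_differentiableD; [apply: h1|apply: h2]; rewrite r0.
Qed.

Lemma locally_unit_differentiableM (D : set C) (f g : C -> C) :
  locally_unit_differentiable D f -> locally_unit_differentiable D g ->
  locally_unit_differentiable D (fun z => f z * g z).
Proof.
move=> fD gD c Dc; have [r1 r10 h1] := fD c Dc; have [r2 r20 h2] := gD c Dc.
exists (Num.min r1 r2); first by rewrite lt_min r10.
move=> r /andP[r0]; rewrite le_min => /andP[l1 l2].
by apply: unit_differentiableM; [apply: h1|apply: h2]; rewrite r0.
Qed.

Definition clusters_at (Z : set C) (c : C) :=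
  forall e : R, 0 < e -> exists z, [/\ 0 < nc (z - c), nc (z - c) < e & Z z].

Definition vanishes_near (g : C -> C) (c : C) :=
  exists2 r : R, 0 < r & forall z, nc (z - c) < r -> g z = 0.

(** A disc around [c] is rescaled to the unit disc, where [unit_differentiable_zeros] applies. *)
Lemma vanishes_near_cluster (D : set C) (g : C -> C) (c : C) :
  locally_unit_differentiable D g -> D c ->
  clusters_at [set z | g z = 0] c -> vanishes_near g c.
Proof.
move=> gD Dc acc; have [r r0 /(_ r)] := gD c Dc; rewrite r0 lexx => /(_ isT) ud.
have rC : r%:C != 0 by rewrite eq_complex /= gt_eqF.
have scale z : nc ((z - c) / r%:C) = nc (z - c) / r.
  by rewrite normcM normcV normc_real gtr0_norm.
have back z : c + r%:C * ((z - c) / r%:C) = z.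
  by rewrite mulrCA mulfV // mulr1 addrC subrK.
exists r => // z zr; rewrite -(back z).
apply: (unit_differentiable_zeros ud); last by rewrite scale ltr_pdivrMr // mul1r.
move=> e e0; have [|w [w0 we gw]] := acc (e * r); first exact: mulr_gt0.
exists ((w - c) / r%:C); rewrite scale divr_gt0 // ltr_pdivrMr // we.
by split => //; rewrite back.
Qed.

(** If the real part [a] were nonzero, the imaginary coordinates of [I ^+ 2], which are [2 * a]
    times those of [I], would force [I] to be real, and a real square is not -1. *)
Lemma imag_unitsP (I : quat R) : imag_units I ->
  qre I = 0 /\ qi I ^+ 2 + qj I ^+ 2 + qk I ^+ 2 = 1.
Proof.
case: I => a b c d; rewrite /imag_units /= expr2 => -[h1 h2 h3 h4].
have a0 : a = 0.
  have [//|/eqP/eqP a0] := eqVneq a 0.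
  have z t : a * t + t * a = 0 -> t = 0.
    move=> h; apply/eqP; have /eqP : (2 * a) * t = 0 by lra.
    by rewrite mulf_eq0 mulf_eq0 pnatr_eq0 /= (negPf a0).
  have b0 : b = 0 by apply: z; lra.
  have c0 : c = 0 by apply: z; lra.
  have d0 : d = 0 by apply: z; lra.
  by move: h1; rewrite b0 c0 d0; have := sqr_ge0 a; rewrite expr2; lra.
by split => //; rewrite a0 in h1; rewrite !expr2; lra.
Qed.

(** The point of the closed upper half-plane whose sphere contains [x]. For conjugation-symmetric
    sets it decides membership of [x] in the circularization, which reduces topology upstairs to
    topology in the plane. *)
Definition half_plane_rep (x : quat R) : C :=
  qre x +i* Num.sqrt (qi x ^+ 2 + qj x ^+ 2 + qk x ^+ 2).

Lemma circularizationP (E : set C) (x : quat R) : conj_symmetric E ->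
  circularization E x <-> E (half_plane_rep x).
Proof.
move=> Esym; split.
  move=> [a [b [I [Eab /imag_unitsP[I0 I1] ->]]]].
  have -> : half_plane_rep (slice_pt a b I) = a +i* `|b|.
    rewrite /half_plane_rep /= I0 !mulr0 mulr1 !addr0 !add0r; congr (_ +i* _).
    by rewrite !exprMn -!mulrDr I1 mulr1 sqrtr_sqr.
  by case: (ger0P b) => // _; exact: (Esym _ Eab).
case: x => a b c d; rewrite /half_plane_rep /=; set s := _ + _ + _.
have s0 : 0 <= s by rewrite !addr_ge0 // sqr_ge0.
(* A real quaternion lies on every slice, so any imaginary unit serves; otherwise the unit is the
   normalized imaginary part. *)
move=> Es; have [sE|sN] := eqVneq s 0.
  exists a, 0, (Quat 0 1 0 0); split.
  - by rewrite sE sqrtr0 in Es.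
  - by rewrite /imag_units /= expr2; congr Quat => /=; ring.
  move/eqP: sE; rewrite !paddr_eq0 ?addr_ge0 ?sqr_ge0 // !sqrf_eq0.
  by move=> /andP[/andP[/eqP -> /eqP ->] /eqP ->]; congr Quat => /=; ring.
have q0 : Num.sqrt s != 0 by rewrite sqrtr_eq0 -ltNge lt_def sN.
exists a, (Num.sqrt s), (Quat 0 (b / Num.sqrt s) (c / Num.sqrt s) (d / Num.sqrt s)).
split => //.
  have h : (b / Num.sqrt s) ^+ 2 + (c / Num.sqrt s) ^+ 2 + (d / Num.sqrt s) ^+ 2 = 1.
    by rewrite !exprMn -!mulrDl exprVn sqr_sqrtr // mulfV.
  by rewrite /imag_units /= expr2; congr Quat => /=; move: h; rewrite ?expr2; lra.
by congr Quat => /=; field.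
Qed.

(** The real part and the norm of the imaginary part are both 1-Lipschitz. *)
Lemma half_plane_rep_lipschitz (x y : quat R) :
  nc (half_plane_rep y - half_plane_rep x) <= 2 * `|y - x|.
Proof.
have im_norm (z : quat R) :
    Num.sqrt (qi z ^+ 2 + qj z ^+ 2 + qk z ^+ 2) = `|Quat 0 (qi z) (qj z) (qk z)|.
  by rewrite -[RHS]/(quat_norm _) /quat_norm /= expr0n add0r.
have im_le (z : quat R) : `|Quat 0 (qi z) (qj z) (qk z)| <= `|z|.
  rewrite -im_norm [leRHS]/(quat_norm z) /quat_norm ler_sqrt.
    by rewrite -!addrA lerDr sqr_ge0.
  by rewrite !addr_ge0 // sqr_ge0.
have re_le (z : quat R) : `|qre z| <= `|z|.
  rewrite [leRHS]/(quat_norm z) /quat_norm -sqrtr_sqr ler_sqrt.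
    by rewrite -!addrA lerDl !addr_ge0 // sqr_ge0.
  by rewrite !addr_ge0 // sqr_ge0.
apply: le_trans (normc_le_ReIm (half_plane_rep y - half_plane_rep x)) _ => /=.
rewrite !im_norm mulr_natl mulr2n; apply: lerD; first exact: (re_le (y - x)).
apply: le_trans (ler_dist_dist _ _) _.
have := im_le (y - x); congr (`|_| <= _).
by congr Quat; rewrite /= ?oppr0 ?addr0.
Qed.

Lemma open_circularization (E : set C) :
  open E -> conj_symmetric E -> open (circularization E).
Proof.
move=> Eo Es; rewrite openE => x /(circularizationP _ Es) Ex.
have /nbhs_normcP[r r0 hr] := open_nbhs_nbhs (conj Eo Ex).
have r2 : 0 < r / 2 by lra.
apply/nbhs_ballP; exists (r / 2) => // y; rewrite -ball_normE /= distrC => xy.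
apply/(circularizationP _ Es)/hr.
by apply: le_lt_trans (half_plane_rep_lipschitz _ _) _; lra.
Qed.

Lemma normc_conj (z : C) : nc z^* = nc z.
Proof. by case: z => a b /=; rewrite sqrrN. Qed.

Lemma openP_normc (E : set C) :
  (forall z, E z -> exists2 r : R, 0 < r & forall w, nc (w - z) < r -> E w) -> open E.
Proof. by move=> h; rewrite openE => z /h/nbhs_normcP. Qed.

(* A clopen conjugation-symmetric part of [D] circularizes to a clopen part of
   the circularization, so connectedness is only needed upstairs. *)
Lemma identity_theorem (D : set C) (g : C -> C) (c : C) :
  open D -> conj_symmetric D -> connected (circularization D) ->
  locally_unit_differentiable D g ->
  (forall z, D z -> g z = 0 -> g z^* = 0) ->
  D c -> clusters_at [set z | g z = 0] c ->
  forall z, D z -> g z = 0.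
Proof.
move=> Do Ds Dconn gD gs Dc acc.
have Dr z : D z -> exists2 r : R, 0 < r & forall w, nc (w - z) < r -> D w.
  by move=> Dz; apply/nbhs_normcP/open_nbhs_nbhs.
pose A := [set z | D z /\ vanishes_near g z].
pose B := [set z | D z /\ ~ vanishes_near g z].
have As : conj_symmetric A.
  move=> z [Dz [r r0 hr]]; split; first exact: Ds.
  have [s s0 hs] := Dr _ Dz.
  exists (Num.min r s) => [|w]; first by rewrite lt_min r0.
  have -> : w - z^* = (w^* - z)^* by rewrite rmorphB /= conjcK.
  rewrite normc_conj lt_min => /andP[/hr gw /hs Dw].
  by rewrite -(conjcK w); apply: gs.
have Bs : conj_symmetric B.
  move=> z [Dz nz]; split; first exact: Ds.
  move=> h; apply: nz; have [_] := As _ (conj (Ds _ Dz) h).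
  by rewrite conjcK.
have Ao : open A.
  apply: openP_normc => z [Dz [r r0 hr]]; have [s s0 hs] := Dr _ Dz.
  have rs0 : 0 < Num.min r s / 2 by rewrite divr_gt0 // lt_min r0.
  have [h1 h2] : Num.min r s <= r /\ Num.min r s <= s by rewrite !ge_min !lexx orbT.
  exists (Num.min r s / 2) => // w wz; split; first by apply: hs; lra.
  exists (Num.min r s / 2) => // v vw; apply: hr.
  have -> : v - z = (v - w) + (w - z) by ring.
  by apply: le_lt_trans (le_normcD _ _) _; lra.
(* Where [g] does not vanish locally, its zeros do not cluster, so a punctured neighbourhood
   contains none of them and lies in [B]. *)
have Bo : open B.
  apply: openP_normc => z [Dz nz]; have [s s0 hs] := Dr _ Dz.
  have /existsNP[e /not_implyP[e0 ne]] : ~ clusters_at [set z | g z = 0] z.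
    by move=> /(vanishes_near_cluster gD Dz).
  exists (Num.min e s); first by rewrite lt_min e0.
  move=> w; rewrite lt_min => /andP[we ws]; split; first exact: hs.
  have [->//|wz] := eqVneq w z.
  move=> [r r0 hr]; apply: ne; exists w; split => //.
    rewrite lt_def normc_ge0 andbT; apply/eqP => /eq0_normc /eqP.
    by rewrite subr_eq0 (negPf wz).
  by apply: hr; rewrite subrr normc0.
(* Connectedness is applied to a nonempty subset that is relatively open, and relatively closed
   because within the circularization of [D] it is the complement of the open circularization of
   [B]. *)
have AD : circularization A = circularization D.
  apply: Dconn.
  - have Ac : A c by split => //; exact: vanishes_near_cluster gD Dc acc.
    exists (slice_pt (complex.Re c) (complex.Im c) (Quat 0 1 0 0)).
    exists (complex.Re c), (complex.Im c), (Quat 0 1 0 0); split => //; first by case: (c) Ac.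
    by rewrite /imag_units /= expr2; congr Quat => /=; ring.
  - exists (circularization A); first exact: open_circularization.
    apply/seteqP; split => x; last by case.
    move=> Ax; split => //; move: Ax => /(circularizationP _ As)[Dx _].
    exact/(circularizationP _ Ds).
  - exists (~` circularization B); first exact/open_closedC/open_circularization.
    apply/seteqP; split => x.
      move=> /(circularizationP _ As)[Dx vx]; split.
        exact/(circularizationP _ Ds).
      by move=> /(circularizationP _ Bs)[].
    move=> [/(circularizationP _ Ds) Dx nB]; apply/(circularizationP _ As); split => //.
    by apply: contrapT => nv; apply: nB; apply/(circularizationP _ Bs).
move=> z Dz.
(* The representative in the upper half-plane recovers [z] only up to conjugation. *)
have : A z \/ A z^*.
  have : circularization A (slice_pt (complex.Re z) (complex.Im z) (Quat 0 1 0 0)).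
    rewrite AD; exists (complex.Re z), (complex.Im z), (Quat 0 1 0 0); split => //.
      by case: (z) Dz.
    by rewrite /imag_units /= expr2; congr Quat => /=; ring.
  move=> /(circularizationP _ As); rewrite /half_plane_rep /=.
  rewrite !mulr0 !addr0 !mulr1 add0r expr0n /= !addr0 sqrtr_sqr.
  case: (z) => a b /=; case: (leP 0 b) => b0; first by rewrite ger0_norm //; left.
  by rewrite ltr0_norm //; right.
case=> [|/As]; rewrite ?conjcK => -[_ [r r0 hr]];
  by apply: hr; rewrite subrr normc0.
Qed.

End IdentityTheorem.

(** * Stem functions and the normal function *)

Section StemComponents.
Variable R : realType.
Local Notation C := R[i].

(** An abstraction of the four real coordinates of a quaternion, which are thus treated at once.
    Additivity is phrased with differences, as difference quotients require. *)
Definition contracting_functional (V : normedModType R) (L : V -> R) :=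
  [/\ forall x y, L (x - y) = L x - L y, forall k x, L (k *: x) = k * L x &
      forall x, `|L x| <= `|x|].

Lemma contracting_functional_continuous (V : normedModType R) (L : V -> R) :
  contracting_functional L -> continuous L.
Proof.
move=> [LB _ Ln] x; apply/cvgrPdist_lt => e e0.
apply/nbhs_ballP; exists e => // y; rewrite -ball_normE /= => xy.
by rewrite -LB; apply: le_lt_trans (Ln _) xy.
Qed.

(** By linearity [L] commutes with difference quotients, and by continuity it passes to their
    limit. *)
Lemma contracting_functional_is_derive (V : normedModType R) (L : V -> R)
    (h : R -> V) (x : R) :
  contracting_functional L -> derivable h x 1 ->
  is_derive x 1 (fun t => L (h t)) (L (derive1 h x)).
Proof.
move=> Lc hd; have [LB LZ _] := Lc.
have lim_h : (fun k => k^-1 *: (L (h (k *: 1 + x)) - L (h x))) @ (0 : R)^' -->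
    L (derive1 h x).
  have -> : (fun k => k^-1 *: (L (h (k *: 1 + x)) - L (h x))) =
      L \o (fun k : R => k^-1 *: (h (k *: 1 + x) - h x)).
    by apply/funext => k /=; rewrite LZ LB.
  apply: continuous_cvg; first exact: contracting_functional_continuous Lc _.
  by rewrite derive1E; exact: hd.
by apply: DeriveDef; [apply/cvg_ex; eexists; exact: lim_h|exact: cvg_lim lim_h].
Qed.

Lemma contracting_cq (L : quat R -> R) : contracting_functional L ->
  contracting_functional (fun x : cquat R => L (cq1 x)) /\
  contracting_functional (fun x : cquat R => L (cq2 x)).
Proof.
move=> [LB LZ Ln]; split; split => [x y|k x|x]; rewrite /= ?LB ?LZ //.
  apply: le_trans (Ln _) _; rewrite [leRHS]/(cquat_norm x) /cquat_norm lerDl //.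
apply: le_trans (Ln _) _; rewrite [leRHS]/(cquat_norm x) /cquat_norm lerDr //.
Qed.

Definition stem_component (L : quat R -> R) (F : C -> cquat R) (z : C) : C :=
  L (cq1 (F z)) +i* L (cq2 (F z)).

(** Applying [L] to the two quaternionic components of the regularity equation gives the
    Cauchy-Riemann equations for the real and imaginary parts of the component. *)
Lemma stem_component_differentiable (L : quat R -> R) (D : set C) (F : C -> cquat R) :
  contracting_functional L -> open D -> C1_on D F ->
  (forall z, D z -> partial_re F z + ciota R * partial_im F z = 0) ->
  locally_unit_differentiable D (stem_component L F).
Proof.
move=> Lc Do [Fd Fc] FCR; have [L1 L2] := contracting_cq Lc.
have LN x : L (- x) = - L x.
  by have [LB _ _] := Lc; rewrite -[- x]sub0r LB -{1}(subrr x) LB subrr sub0r.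
have cont (M : cquat R -> R) (G : C -> cquat R) z : contracting_functional M ->
    {for z, continuous G} -> {for z, continuous (fun w => M (G w))}.
  move=> Mc Gc; apply: (continuous_comp Gc).
  exact: contracting_functional_continuous Mc _.
pose p z := L (cq1 (partial_re F z)); pose q z := L (cq2 (partial_re F z)).
have CR z : D z -> L (cq1 (partial_im F z)) = - q z /\ L (cq2 (partial_im F z)) = p z.
  move=> /FCR; rewrite /q /p; case: (partial_re F z) (partial_im F z) => [a b] [c d].
  move=> h; move: (congr1 (@cq1 R) h) (congr1 (@cq2 R) h) => /=.
  rewrite !(mul0r, mul1r, sub0r, add0r) => /eqP.
  rewrite subr_eq0 => /eqP -> /eqP; rewrite addrC addr_eq0 => /eqP ->.
  by rewrite LN.
apply: (@cauchy_riemann R D _ _ p q) => // z Dz; have [Fdr Fdi] := Fd z Dz;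
  have [Fcr Fci] := Fc z Dz; have [CR1 CR2] := CR z Dz; split.
- exact: (contracting_functional_is_derive L1 Fdr).
- by rewrite -CR1; exact: (contracting_functional_is_derive L1 Fdi).
- exact: (cont _ _ _ L1 Fcr).
- by apply: continuousN; exact: (cont _ _ _ L2 Fcr).
- exact: (contracting_functional_is_derive L2 Fdr).
- by rewrite -CR2; exact: (contracting_functional_is_derive L2 Fdi).
- exact: (cont _ _ _ L2 Fcr).
- exact: (cont _ _ _ L1 Fcr).
Qed.

Lemma quat_coord_contracting :
  [/\ contracting_functional (@qre R), contracting_functional (@qi R),
      contracting_functional (@qj R) & contracting_functional (@qk R)].
Proof.
by split; split => // -[a b c d]; rewrite [leRHS]/(quat_norm _) /quat_norm -sqrtr_sqr
  ler_sqrt /= ?addr_ge0 ?sqr_ge0 //;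
  have := sqr_ge0 a; have := sqr_ge0 b; have := sqr_ge0 c; have := sqr_ge0 d; lra.
Qed.

(* The value at [z] of [F F^c], the stem function of the normal function of [f]:
   it takes values in the centre, identified with the complex numbers. *)
Definition normal_stem (F : C -> cquat R) (z : C) : C :=
  stem_component (@qre R) F z * stem_component (@qre R) F z +
  stem_component (@qi R) F z * stem_component (@qi R) F z +
  stem_component (@qj R) F z * stem_component (@qj R) F z +
  stem_component (@qk R) F z * stem_component (@qk R) F z.

(** The real part of [normal_stem] is the difference of the squared norms of F1 and F2, and the
    imaginary part is twice their scalar product. If F1 = - I F2, the norms agree because [I] has
    norm 1, and F1 is orthogonal to F2 because [I] has real part 0. *)
Lemma normal_stem_eq0 (F : C -> cquat R) (z : C) (I : quat R) :
  imag_units I -> cq1 (F z) + I * cq2 (F z) = 0 -> normal_stem F z = 0.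
Proof.
move=> /imag_unitsP; rewrite /normal_stem /stem_component.
case: (F z) => [[a1 b1 c1 d1] [a2 b2 c2 d2]]; case: I => x b c d /= [-> h].
move=> [/eqP + /eqP + /eqP + /eqP]; rewrite !addr_eq0.
move=> /eqP -> /eqP -> /eqP -> /eqP ->.
apply/eqP; rewrite eq_complex /=; apply/andP; split; apply/eqP; last by ring.
rewrite !mul0r.
transitivity ((b ^+ 2 + c ^+ 2 + d ^+ 2 - 1) * (a2 ^+ 2 + b2 ^+ 2 + c2 ^+ 2 + d2 ^+ 2)).
  by ring.
by rewrite h subrr mul0r.
Qed.

Lemma stem_component_conj (L : quat R -> R) (D : set C) (F : C -> cquat R) (z : C) :
  contracting_functional L -> stem_function D F -> D z ->
  stem_component L F z^* = (stem_component L F z)^*.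
Proof.
move=> [LB _ _] Fs Dz; rewrite /stem_component Fs //=.
by rewrite -[- cq2 _]sub0r LB -{1}(subrr (cq2 (F z))) LB subrr sub0r.
Qed.

(** Compactness is applied to the filter of sets containing all but finitely many points of [S],
    which is proper because [S] is infinite. Removing [c] from [S] leaves a member of the filter, so
    the points found near [c] differ from it. *)
Lemma infinite_clusters_at (K S : set C) : compact K -> S `<=` K ->
  ~ finite_set S -> exists2 c, K c & clusters_at S c.
Proof.
move=> Kc SK Sinf.
pose G := [set A : set C | finite_set (S `\` A)].
have GF : ProperFilter G.
  split; first by rewrite /G /= setD0.
  split.
  - by rewrite /G /= setDT; exact: finite_set0.
  - by move=> A B; rewrite /G /= setDIr => fA fB; rewrite finite_setU.
  - by move=> A B AB; apply: sub_finite_set; exact: setDS.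
have GK : G K by rewrite /G /= (_ : S `\` K = set0) ?setD_eq0.
have [c [Kc' cl]] := Kc G GF GK.
exists c => // e e0.
have GA : G (S `\ c).
  apply: (sub_finite_set _ (finite_set1 c)) => z [Sz h].
  by apply: contrapT => zc; apply: h.
have Bc : nbhs c [set z : C | nc (z - c) < e] by apply/nbhs_normcP; exists e.
have [z [[Sz zc] ze]] := cl _ _ GA Bc.
exists z; split => //.
rewrite lt_def normc_ge0 andbT; apply/eqP => /eq0_normc /eqP.
by rewrite subr_eq0 => /eqP.
Qed.

(** Finite sets are closed in a Hausdorff space, so the complement of [K] without [z] is a
    neighbourhood of [z]. *)
Lemma finite_no_limit_point (K : set C) (z : C) : finite_set K -> ~ limit_point K z.
Proof.
move=> Kfin lim.
have fin : finite_set (K `\ z) by exact: finite_setD.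
have cl : closed (K `\ z).
  have /accessible_finite_set_closed : accessible_space C by
    apply: hausdorff_accessible; exact: norm_hausdorff.
  exact.
have nz : nbhs z (~` (K `\ z)).
  by apply: open_nbhs_nbhs; split; [exact: closed_openC|move=> [_ /(_ erefl)]].
by have [y [/eqP yz Ky]] := lim _ nz; apply; split.
Qed.

End StemComponents.

(** * Zeros of a regular function over a compact set *)

Theorem corollary1p15 (R : realType) (D : set R[i]) (f : quat R -> quat R)
    (K : set R[i]) :
  slice_domain D ->
  slice_regular D f ->
  K `<=` D ->
  compact K ->
  (exists2 z, K z & limit_point K z) ->
  let Zfin := finite_set (complex_trace (zero_set D f) `&` K) in
  let fzero := forall x, circularization D x -> f x = 0 in
  (Zfin \/ fzero) /\ ~ (Zfin /\ fzero).
Proof.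
move=> [Do Ds [_ _ Dconn] [a Da]] [F [Fs Ff FC1 FCR]] KD Kc [z0 Kz0 limz0] Zfin fzero.
have [Lr Li Lj Lk] := quat_coord_contracting R.
split; last first.
  (* The alternatives exclude each other: for [f] identically zero the trace contains all of [K],
     which cannot be finite since it has a limit point. *)
  move=> [Zf f0]; apply: (finite_no_limit_point _ limz0).
  apply: sub_finite_set Zf => z Kz; split => //.
  exists (Quat 0 1 0 0); first by rewrite /imag_units /= expr2; congr Quat => /=; ring.
  have cz : circularization D (slice_pt (complex.Re z) (complex.Im z) (Quat 0 1 0 0)).
    exists (complex.Re z), (complex.Im z), (Quat 0 1 0 0); split => //.
      by case: z Kz => x y /KD.
    by rewrite /imag_units /= expr2; congr Quat => /=; ring.
  by split => //; exact: f0.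
have [|Zinf] := pselect Zfin; [by left|right].
have ud L : contracting_functional L ->
    locally_unit_differentiable D (stem_component L F).
  by move=> Lc; exact: stem_component_differentiable Lc Do FC1 FCR.
have conjE L z : contracting_functional L -> D z ->
    stem_component L F z^* = (stem_component L F z)^*.
  by move=> Lc; exact: stem_component_conj Lc Fs.
have N0 z : D z -> normal_stem F z = 0.
  have [c Kc' acc] := infinite_clusters_at Kc (@subIsetr _ _ _) Zinf.
  apply: (identity_theorem (c := c) Do Ds Dconn).
  - by do !apply: locally_unit_differentiableD;
      apply: locally_unit_differentiableM; exact: ud.
  - move=> w Dw; rewrite /normal_stem !conjE // => h.
    by rewrite -!rmorphM -!rmorphD h rmorph0.
  - exact: KD.
  - move=> e /acc[w [w0 we [[I II [cw fw]] Kw]]]; exists w; split => //.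
    apply: (normal_stem_eq0 II).
    by case: (w) (KD _ Kw) fw => x y Dxy /=; rewrite (Ff _ _ _ Dxy II).
(* A real point is its own conjugate, so the stem symmetry makes each component real there. *)
have comp0 t L : D t%:C -> contracting_functional L ->
    complex.Im (stem_component L F t%:C) = 0.
  by move=> Dt Lc; have := conjE _ _ Lc Dt; rewrite conjc_real => /= -[]; lra.
have real0 t : D t%:C -> [/\ stem_component (@qre R) F t%:C = 0,
    stem_component (@qi R) F t%:C = 0, stem_component (@qj R) F t%:C = 0 &
    stem_component (@qk R) F t%:C = 0].
  move=> Dt; have := N0 _ Dt; rewrite /normal_stem.
  have := comp0 _ _ Dt Lr; have := comp0 _ _ Dt Li.
  have := comp0 _ _ Dt Lj; have := comp0 _ _ Dt Lk.
  rewrite /stem_component /= => -> -> -> -> [+ _].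
  rewrite !mulr0 !subr0 => /eqP; rewrite -!expr2 !paddr_eq0 ?addr_ge0 ?sqr_ge0 //.
  by rewrite !sqrf_eq0 => /andP[/andP[/andP[/eqP -> /eqP ->] /eqP ->] /eqP ->].
have F0 L : contracting_functional L ->
    (forall t, D t%:C -> stem_component L F t%:C = 0) ->
    forall z, D z -> stem_component L F z = 0.
  move=> Lc L0; apply: (identity_theorem (c := a%:C) Do Ds Dconn) => //.
  - exact: ud.
  - by move=> w Dw; rewrite conjE // => ->; rewrite conjc0.
  - move=> e e0; have /nbhs_normcP[r r0 hr] := open_nbhs_nbhs (conj Do Da).
    have [m1 m2] : Num.min e r <= e /\ Num.min e r <= r by rewrite !ge_min !lexx orbT.
    have m0 : 0 < Num.min e r by rewrite lt_min e0.
    have d : nc ((a + Num.min e r / 2)%:C - a%:C) = Num.min e r / 2.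
      by rewrite -rmorphB normc_real addrC addKr gtr0_norm //; lra.
    (* As [D] is open around the real point [a], nearby real points also lie in [D], and the
       component vanishes there by assumption. *)
    exists (a + Num.min e r / 2)%:C; rewrite d; split; [lra|lra|].
    by apply: L0; apply: hr; rewrite d; lra.
move=> x [b [c [I [Dbc II ->]]]]; rewrite (Ff _ _ _ Dbc II).
have := F0 _ Lr (fun t Dt => let: And4 h _ _ _ := real0 t Dt in h) _ Dbc.
have := F0 _ Li (fun t Dt => let: And4 _ h _ _ := real0 t Dt in h) _ Dbc.
have := F0 _ Lj (fun t Dt => let: And4 _ _ h _ := real0 t Dt in h) _ Dbc.
have := F0 _ Lk (fun t Dt => let: And4 _ _ _ h := real0 t Dt in h) _ Dbc.
rewrite /stem_component; case: (F _) => [[x1 x2 x3 x4] [y1 y2 y3 y4]] /=.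
by move=> [-> ->] [-> ->] [-> ->] [-> ->]; rewrite mulr0 addr0.
Qed.
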